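(* Let $A$ be a self-adjoint Schauder operator on $\mathcal{H}$. (i) Let $0<\lambda_1<\lambda_2$ be such that $\sigma(A)\subseteq[\lambda_1,\lambda_2]$ and $\lambda_1,\lambda_2\in\sigma_e(A)$. Then for every ring $R\subseteq R^o_{\lambda_1,\lambda_2}$ there exists a unitary spread operator $U$ such that $\sigma_S(UA)\supseteq R$. (ii) Let $0<\lambda_1<\lambda_2$ be such that $\lambda_1,\lambda_2\in\sigma_e(A)$. Then for every ring $R\subseteq R^o_{\lambda_1,\lambda_2}$ there exists a unitary spread operator $U$ such that $\sigma_S(UA)\supseteq R$. (iii) Suppose $\sigma_e(A)$ consists of exactly one point $\lambda_1>0$, and that there are sequences $\{t_k\}_{k=1}^\infty$ and $\{r_k\}_{k=1}^\infty$ contained in $\sigma(A)$ such that $t_k<t_{k+1}$ and $r_k>r_{k+1}$ for all $k$, $t_k\to\lambda_1$, $r_k\to\lambda_1$, and $$\sum_{n=1}^\infty\prod_{k=1}^n\Big(\frac{t_k}{\lambda_1}\Big)^2<\infty,\qquad \sum_{n=1}^\infty\prod_{k=1}^n\Big(\frac{\lambda_1}{r_k}\Big)^2<\infty .$$ Then there exists a unitary spread operator $U$ such that $\sigma_S(UA)\supseteq\{\lambda\in\mathbb{C}: |\lambda|=\lambda_1\}$.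
   Context: $\mathcal{H}$ is a separable infinite-dimensional complex Hilbert space; operators are bounded linear operators on $\mathcal{H}$; ONB means orthonormal basis. $\sigma(\cdot)$ is the spectrum and $\sigma_e(\cdot)$ the essential spectrum. A sequence $\{f_n\}_{n=1}^\infty$ in $\mathcal{H}$ is a Schauder basis if every $f\in\mathcal{H}$ has a unique norm-convergent expansion $f=\sum c_nf_n$. Given an ONB $\{e_m\}_{m=1}^\infty$ and a Schauder basis $\{f_n\}$, write $f_n=\sum_m f_{mn}e_m$; the infinite matrix $(f_{mn})$ is called a Schauder matrix (its columns form a Schauder basis). An operator is a Schauder operator if it has a Schauder matrix representation under some ONB of $\mathcal{H}$. The Schauder spectrum $\sigma_S(T)$ of an operator $T$ is the set of $\lambda\in\mathbb{C}$ for which there is no ONB under which $\lambda I-T$ is represented by a Schauder matrix. Given an ONB $\{e_n\}_{n=1}^\infty$ and infinite subsets $A'=\{a_1<a_2<\cdots\}$, $B'=\{b_1<b_2<\cdots\}$ of $\mathbb{N}$, the spread $S_{A',B'}$ from $A'$ to $B'$ is the linear map with $S_{A',B'}e_n=0$ if $n\notin A'$ and $S_{A',B'}e_{a_k}=e_{b_k}$ for every $k$. A unitary operator $U$ is a unitary spread (operator) if, with respect to some ONB, there is a sequence of spreads $\{S_{A_n,B_n}\}_{n=1}^\infty$ such that $\sum_{n=1}^\infty S_{A_n,B_n}$ converges to $U$ in the strong operator topology. For $0<\lambda_1<\lambda_2$, $R^o_{\lambda_1,\lambda_2}=\{\lambda\in\mathbb{C}:\lambda_1<|\lambda|<\lambda_2\}$.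 A ring in $R^o_{\lambda_1,\lambda_2}$ is an open annulus $\{\lambda\in\mathbb{C}: a<|\lambda|<b\}$ with $\lambda_1\le a<b\le\lambda_2$. *)

(* Defs.v *)
From HB Require Import structures.
From mathcomp Require Import all_boot all_order all_algebra.
From mathcomp Require Import complex.
From mathcomp Require Import all_classical all_reals all_analysis.

Set Implicit Arguments.
Unset Strict Implicit.
Unset Printing Implicit Defensive.

Import Order.TTheory GRing.Theory Num.Theory.
Import numFieldNormedType.Exports.

Local Open Scope classical_set_scope.
Local Open Scope ring_scope.
Local Open Scope complex_scope.

(* A complex Hilbert space is a complete normed module [H] over [R[i]] with an
   inner product [ip], linear in its first argument, inducing the norm of [H].
   Sequences are indexed from 0. *)

Section Hilbert.
Context (R : realType) (H : completeNormedModType R[i]).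

Definition norm_induced_by (ip : {dot H for Num.conj}) : Prop :=
  forall x : H, `|x| ^+ 2 = ip x x.

Definition separable : Prop := exists2 D : set H, countable D & dense D.

Definition fin_span (n : nat) (v : 'I_n -> H) : set H :=
  [set x | exists c : 'I_n -> R[i], x = \sum_(i < n) c i *: v i].

Definition finite_dim (V : set H) : Prop :=
  exists n (v : 'I_n -> H), V = fin_span v.

Definition finite_codim (V : set H) : Prop :=
  exists n (v : 'I_n -> H),
    forall x, exists2 y, V y & fin_span v (x - y).

Definition infinite_dimensional : Prop := ~ finite_dim [set: H].

Definition lin_span (e : nat -> H) : set H :=
  [set x | exists n (c : nat -> R[i]), x = \sum_(i < n) c i *: e i].

Definition scalar_minus (l : R[i]) (T : H -> H) : H -> H :=
  fun x => l *: x - T x.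

Definition invertible_operator (T : H -> H) : Prop :=
  exists S : {linear H -> H}, [/\ continuous S, cancel T S & cancel S T].

Definition spectrum (T : H -> H) : set R[i] :=
  [set l | ~ invertible_operator (scalar_minus l T)].

Definition fredholm (T : H -> H) : Prop :=
  [/\ finite_dim [set x | T x = 0], closed (range T) & finite_codim (range T)].

Definition essential_spectrum (T : H -> H) : set R[i] :=
  [set l | ~ fredholm (scalar_minus l T)].

Definition schauder_basis (f : nat -> H) : Prop :=
  forall x : H, exists! c : nat -> R[i],
    series (fun n => c n *: f n) @ \oo --> x.

Definition increasing_enumeration (A : set nat) (a : nat -> nat) : Prop :=
  range a = A /\ (forall k, (a k < a k.+1)%N).

Definition is_spread (e : nat -> H) (A B : set nat) (S : H -> H) : Prop :=
  exists a b : nat -> nat,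
    [/\ increasing_enumeration A a, increasing_enumeration B b,
        (forall n, ~ A n -> S (e n) = 0) &
        (forall k, S (e (a k)) = e (b k))].

Variable ip : {dot H for Num.conj}.

Definition is_onb (e : nat -> H) : Prop :=
  (forall m n, ip (e m) (e n) = (m == n)%:R) /\ dense (lin_span e).

Definition is_adjoint (T S : H -> H) : Prop :=
  forall x y, ip (T x) y = ip x (S y).

Definition self_adjoint (T : H -> H) : Prop := is_adjoint T T.

Definition unitary (U : {linear H -> H}) : Prop :=
  exists V : {linear H -> H},
    [/\ continuous V, is_adjoint U V, cancel U V & cancel V U].

(* Entry (m, n) is the coefficient of [e m] in the expansion of [f n]. *)
Definition coefficient_matrix (e f : nat -> H) : nat -> nat -> R[i] :=
  fun m n => ip (f n) (e m).

Definition schauder_matrix (M : nat -> nat -> R[i]) : Prop :=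
  exists e f : nat -> H,
    [/\ is_onb e, schauder_basis f & M = coefficient_matrix e f].

Definition operator_matrix (T : H -> H) (e : nat -> H) : nat -> nat -> R[i] :=
  coefficient_matrix e (T \o e).

Definition schauder_operator (T : H -> H) : Prop :=
  exists2 e : nat -> H, is_onb e & schauder_matrix (operator_matrix T e).

Definition schauder_spectrum (T : H -> H) : set R[i] :=
  [set l | ~ schauder_operator (scalar_minus l T)].

Definition unitary_spread (U : {linear H -> H}) : Prop :=
  [/\ continuous U, unitary U &
      exists (e : nat -> H) (A B : nat -> set nat) (S : nat -> {linear H -> H}),
        [/\ is_onb e,
            (forall n, infinite_set (A n) /\ infinite_set (B n)),
            (forall n, continuous (S n) /\ is_spread e (A n) (B n) (S n)) &
            (forall x, series (fun n => S n x) @ \oo --> U x)]].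

End Hilbert.

Section Rings.
Context (R : realType).

Definition open_annulus (a b : R) : set R[i] :=
  [set z | a%:C < `|z| < b%:C].

Definition is_ring_in (l1 l2 : R) (Q : set R[i]) : Prop :=
  exists a b : R, [/\ l1 <= a, a < b, b <= l2 & Q = open_annulus a b].

End Rings.

(* Main.v *)
Require Import Defs.
From HB Require Import structures.
From mathcomp Require Import all_boot all_order all_algebra.
From mathcomp Require Import complex.
From mathcomp Require Import all_classical all_reals all_analysis.
From mathcomp Require Import ring lra zify.

Set Implicit Arguments.
Unset Strict Implicit.
Unset Printing Implicit Defensive.

Import Order.TTheory GRing.Theory Num.Theory.
Import numFieldNormedType.Exports.

Local Open Scope complex_scope.
Local Open Scope classical_set_scope.
Local Open Scope ring_scope.

(** Every eigenvalue [l] of [U A] lies in the Schauder spectrum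
    ([eigenvalue_schauder_spectrum]): the matrix of a Schauder operator
    determines a Schauder basis, along which the coordinates of a kernel vector
    of [l - U A] would be a nontrivial expansion of 0.  So it is enough to find
    a permutation [U] of an orthonormal basis such that [U A] contains a
    bilateral weighted shift
      [... b 1 -> b 0 -> a 0 -> a 1 -> ...]
    whose eigenvectors at the required [l] are square summable
    ([bilateral_shift_eigenvector]).  If [w k] and [v k] are the weights on
    the two sides, this needs the products of the ratios [w k / |l|] and of the
    ratios [|l| / v k] to be square summable.

    Any permutation of an orthonormal basis is a unitary spread, because a
    permutation of the naturals splits into infinitely many infinite increasing
    pieces ([increasing_coloring], [permutation_unitary_spread]).  Moreover any
    orthonormal sequence extends to an orthonormal basis, so it suffices to
    prescribe how [U] permutes an orthonormal sequence
    ([orthonormal_permutation_spread]).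

    Let [0 < l1 < l2] be in the essential spectrum.  As [l1 - A] and [l2 - A] are
    symmetric and not Fredholm, each of them is arbitrarily small at some unit
    vector orthogonal to any given finite set ([singular_vector]).  This gives
    unit vectors [g_s] with [A g_s] close to [l1 g_s] or to [l2 g_s], as
    prescribed, such that the planes containing [g_s] and [A g_s] are mutually
    orthogonal ([block_sequence]).  The required isometry
    [A g_s / |A g_s| |-> g_(next s)] maps each plane to the next one.  It need
    not permute the given bases of the planes, but after rotating these bases
    suitably, one plane after the other, it does ([block_shift]).  The weights
    [|A g_s|] tend to [l1] on one side and to [l2] on the other, so every [l]
    with [l1 < |l| < l2] is an eigenvalue.

    In the third part the points [t k] and [r k] are isolated: the operator
    [t k - A] is Fredholm but not invertible, so it has a kernel
    ([isolated_eigenvalue]; continuity of the inverse of a symmetric bijection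
    is a gliding hump argument, [symmetric_onto_bounded_below]).  Shifting the
    orthonormal eigenvectors gives exactly the weights [t k] and [r k], and the
    two series in the hypotheses are, up to the coefficient 1 at [a 0], the
    squared norms of the two halves of an eigenvector for [|l| = l1]. *)

(** * Norms with real values *)

Section RealNorm.
Context {R : realType}.

(** The norm as an element of the totally ordered field [R] instead of
    [R[i]]. *)
Definition rnorm (V : normedZmodType R[i]) (x : V) : R := complex.Re `|x|.

Section Zmod.
Context {V : normedZmodType R[i]}.
Implicit Types x y : V.

Lemma rnormE x : (rnorm x)%:C = `|x|.
Proof. by rewrite /rnorm RRe_real// normr_real. Qed.

Lemma rnorm_ge0 x : 0 <= rnorm x.
Proof. by rewrite -lecR rnormE normr_ge0. Qed.

Lemma rnorm0 : rnorm (0 : V) = 0.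
Proof. by rewrite /rnorm normr0. Qed.

Lemma rnorm_eq0 x : (rnorm x == 0) = (x == 0).
Proof. by rewrite -[RHS]normr_eq0 -rnormE -(inj_eq (@complexI R)). Qed.

Lemma rnorm_gt0 x : (0 < rnorm x) = (x != 0).
Proof. by rewrite lt0r rnorm_eq0 rnorm_ge0 andbT. Qed.

Lemma rnormN x : rnorm (- x) = rnorm x.
Proof. by rewrite /rnorm normrN. Qed.

Lemma rnormB x y : rnorm (x - y) = rnorm (y - x).
Proof. by rewrite -rnormN opprB. Qed.

Lemma ler_rnormD x y : rnorm (x + y) <= rnorm x + rnorm y.
Proof. by rewrite -lecR rmorphD/= !rnormE ler_normD. Qed.

Lemma ler_rnormB x y : rnorm x - rnorm y <= rnorm (x - y).
Proof. by rewrite lerBlDr (le_trans _ (ler_rnormD _ _))// subrK. Qed.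

End Zmod.

Lemma rnormM (a b : R[i]) : rnorm (a * b) = rnorm a * rnorm b.
Proof. by apply: complexI; rewrite rmorphM/= !rnormE normrM. Qed.

Lemma rnormV (a : R[i]) : rnorm a^-1 = (rnorm a)^-1.
Proof. by apply: complexI; rewrite fmorphV/= !rnormE normfV. Qed.

Lemma rnorm_real (a : R) : rnorm (a%:C) = `|a|.
Proof. by rewrite /rnorm normc_def/= expr0n addr0 sqrtr_sqr. Qed.

Section NormedModule.
Context {V : normedModType R[i]}.

Lemma rnormZ (a : R[i]) (x : V) : rnorm (a *: x) = rnorm a * rnorm x.
Proof. by apply: complexI; rewrite rmorphM/= !rnormE normrZ. Qed.

Lemma rnorm_normalize (x : V) : x != 0 -> rnorm ((rnorm x)^-1%:C *: x) = 1.
Proof.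
move=> x0; rewrite rnormZ rnorm_real ger0_norm ?invr_ge0 ?rnorm_ge0//.
by rewrite mulVf// rnorm_eq0.
Qed.

Lemma posc_Re (e : R[i]) : 0 < e -> 0 < complex.Re e /\ (complex.Re e)%:C = e.
Proof.
move=> e0; have er : e \is Num.real by rewrite gtr0_real.
by rewrite -ltcR RRe_real.
Qed.

Lemma cvg_rnormP (u : nat -> V) (l : V) :
  u @ \oo --> l <-> (fun n => rnorm (u n - l)) @ \oo --> (0 : R).
Proof.
split=> [/cvgrPdist_lt ul|/cvgrPdist_lt ul]; apply/cvgrPdist_lt => e e0.
  have /ul : 0 < e%:C by rewrite ltcR.
  apply: filterS => n; rewrite -rnormE ltcR sub0r normrN ger0_norm ?rnorm_ge0//.
  by rewrite rnormB.
have [e0' <-] := posc_Re e0; have := ul _ e0'.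
apply: filterS => n; rewrite -rnormE ltcR sub0r normrN ger0_norm ?rnorm_ge0//.
by rewrite rnormB.
Qed.

Lemma cvg_rnorm (u : nat -> V) (l : V) :
  u @ \oo --> l -> (fun n => rnorm (u n)) @ \oo --> rnorm l.
Proof.
move=> /cvgrPdist_lt ul; apply/cvgrPdist_lt => e e0.
have /ul : 0 < e%:C by rewrite ltcR.
apply: filterS => n; rewrite -rnormE ltcR; apply: le_lt_trans.
rewrite ler_norml ler_rnormB andbT lerNl opprB.
by rewrite rnormB ler_rnormB.
Qed.

Lemma rnorm_lipschitz_continuous (W : normedModType R[i]) (f : {linear V -> W})
    (C : R) : (forall x, rnorm (f x) <= C * rnorm x) -> continuous f.
Proof.
move=> fC x; apply/cvgrPdist_lt => e e0.
have [e0' <-] := posc_Re e0.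
have C1 : 0 < `|C| + 1 by rewrite ltr_wpDl.
have d0 : 0 < (complex.Re e / (`|C| + 1))%:C by rewrite ltcR divr_gt0.
have : (nbhs x) (fun y => `|x - y| < (complex.Re e / (`|C| + 1))%:C).
  by have /cvgrPdist_lt := @cvg_id V (nbhs x); exact.
apply: filterS => y; rewrite -rnormE ltcR ltr_pdivlMr// => xy.
rewrite -rnormE ltcR -linearB (le_lt_trans (fC _))// (le_lt_trans _ xy)//.
rewrite mulrC ler_wpM2l ?rnorm_ge0// (le_trans (ler_norm _))//.
by rewrite lerDl.
Qed.

End NormedModule.

Lemma small_unit_vector (V W : normedModType R[i]) (f : {linear V -> W}) (e : R)
    (x : V) : rnorm (f x) < e * rnorm x ->
  let y := (rnorm x)^-1%:C *: x in rnorm y = 1 /\ rnorm (f y) < e.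
Proof.
move=> fx; have x0 : x != 0.
  by apply: contraTneq fx => ->; rewrite linear0 !rnorm0 mulr0 ltxx.
split; first exact: rnorm_normalize.
rewrite linearZ/= rnormZ rnorm_real ger0_norm ?invr_ge0 ?rnorm_ge0//.
by rewrite mulrC ltr_pdivrMr// rnorm_gt0.
Qed.

Lemma cvgn_uniq (V : normedModType R[i]) (u : nat -> V) (a b : V) :
  u @ \oo --> a -> u @ \oo --> b -> a = b.
Proof. by move=> ua ub; apply: (cvg_unique _ ua ub); exact: norm_hausdorff. Qed.

Lemma cvgn_linear (V W : normedModType R[i]) (f : {linear V -> W}) (u : nat -> V)
    (a : V) : continuous f -> u @ \oo --> a -> (fun n => f (u n)) @ \oo --> f a.
Proof. by move=> fc ua; apply: continuous_cvg => //; exact: fc. Qed.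

Lemma linear_series (V W : normedModType R[i]) (f : {linear V -> W})
    (u : nat -> V) n : f (series u n) = series (fun k => f (u k)) n.
Proof. by rewrite /series/= raddf_sum. Qed.

Lemma cauchy_rnorm_cvgn (V : completeNormedModType R[i]) (u : nat -> V) :
  (forall e : R, 0 < e -> exists N, forall m n, (N <= m)%N -> (m <= n)%N ->
     rnorm (u n - u m) < e) -> cvgn u.
Proof.
move=> uc; apply: cauchy_cvg; apply/cauchy_ballP => e e0.
have [e0' <-] := posc_Re e0; have [N NP] := uc _ e0'.
rewrite near_map2; exists ([set n | (N <= n)%N], [set n | (N <= n)%N]) => /=.
  by split; exists N.
case=> m n [/= Nm Nn]; rewrite -ball_normE/= -rnormE ltcR.
by have [mn|/ltnW mn] := leqP m n; [rewrite rnormB|]; exact: NP.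
Qed.

End RealNorm.

(** * Orthonormal series *)

Section InnerProduct.
Context {R : realType} {H : completeNormedModType R[i]}.
Variable ip : {dot H for Num.conj}.
Hypothesis ip_norm : norm_induced_by ip.
Implicit Types (x y z : H) (u e F : nat -> H) (c : nat -> R[i]).

Lemma ipC x y : ip y x = (ip x y)^*.
Proof. by rewrite hermC/= expr0 mul1r. Qed.

Lemma ipDl x y z : ip (x + y) z = ip x z + ip y z.
Proof. exact: linearDl. Qed.

Lemma ipDr x y z : ip z (x + y) = ip z x + ip z y.
Proof. exact: linearDr. Qed.

Lemma ipZl (a : R[i]) x y : ip (a *: x) y = a * ip x y.
Proof. exact: linearZl_LR. Qed.

Lemma ipZr (a : R[i]) x y : ip x (a *: y) = a^* * ip x y.
Proof. exact: linearZr_LR. Qed.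

Lemma ip_eq0C x y : ip x y = 0 -> ip y x = 0.
Proof. by move=> xy; rewrite ipC xy rmorph0. Qed.

Lemma ip_self x : ip x x = (rnorm x ^+ 2)%:C.
Proof. by rewrite rmorphXn/= rnormE ip_norm. Qed.

Lemma rnorm_unit x : rnorm x = 1 -> ip x x = 1.
Proof. by move=> x1; rewrite ip_self x1 expr1n. Qed.

Lemma ip_self1 x : ip x x = 1 -> rnorm x = 1.
Proof.
rewrite ip_self => /(@complexI _ _ 1)/eqP.
by rewrite sqrp_eq1 ?rnorm_ge0// => /eqP.
Qed.

Lemma pythagoras x y :
  ip x y = 0 -> rnorm (x + y) ^+ 2 = rnorm x ^+ 2 + rnorm y ^+ 2.
Proof.
move=> xy; apply: (@complexI R); rewrite rmorphD/= -!ip_self.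
by rewrite hnormDd.
Qed.

Lemma cauchy_schwarz x y : rnorm (ip x y) <= rnorm x * rnorm y.
Proof.
have [->|y0] := eqVneq y 0; first by rewrite linear0r rnorm0 mulr_ge0 ?rnorm_ge0.
have yp : 0 < rnorm y by rewrite rnorm_gt0.
pose a := ip x y / ip y y; pose z := x - a *: y.
have yy0 : ip y y != 0 by rewrite dnorm_eq0.
have zy : ip z (a *: y) = 0.
  rewrite linearZr_LR/= /z linearBl/= linearZl_LR/= /a divfK// subrr.
  by rewrite mulr0.
have : rnorm x ^+ 2 = rnorm z ^+ 2 + rnorm (a *: y) ^+ 2.
  by rewrite -pythagoras// subrK.
have -> : rnorm (a *: y) = rnorm (ip x y) / rnorm y.
  rewrite rnormZ rnormM rnormV ip_self rnorm_real ger0_norm ?sqr_ge0//.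
  by rewrite -mulrA; congr *%R; rewrite expr2 invfM mulrAC mulVf ?mul1r// gt_eqF.
move=> xE; rewrite -ler_pdivrMr// -ler_sqr ?nnegrE ?divr_ge0 ?rnorm_ge0//.
by rewrite xE lerDr sqr_ge0.
Qed.

Lemma ip_cvg u x y : u @ \oo --> x ->
  (fun n => ip (u n) y : R[i]^o) @ \oo --> (ip x y : R[i]^o).
Proof.
move=> /cvg_rnormP ux; apply/cvg_rnormP.
have : (fun n => rnorm (u n - x) * rnorm y) @ \oo --> 0 * rnorm y.
  by apply: cvgMl.
rewrite mul0r; apply: squeeze_cvgr; last exact: cvg_cst.
by near=> n; rewrite rnorm_ge0/= -linearBl cauchy_schwarz.
Unshelve. all: by end_near. Qed.

Lemma near_ip_lim u x y (a : R[i]) : u @ \oo --> x ->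
  (\forall n \near \oo, ip (u n) y = a) -> ip x y = a.
Proof.
move=> ux una; apply: (cvgn_uniq (ip_cvg (y := y) ux)).
apply: (@cvg_trans _ ((fun=> a : R[i]^o) @ \oo)); last exact: cvg_cst.
by apply: near_eq_cvg; apply: filterS una => n ->.
Qed.

Lemma ip_lim_eq0 u x y : u @ \oo --> x -> (forall n, ip (u n) y = 0) ->
  ip x y = 0.
Proof. by move=> ux u0; apply: near_ip_lim ux _; apply: nearW. Qed.

Lemma rnorm_lim_le u x (M : R) : u @ \oo --> x -> (forall n, rnorm (u n) <= M) ->
  rnorm x <= M.
Proof.
move=> /cvg_rnorm ux uM; rewrite -(cvg_lim (@Rhausdorff R) ux).
by apply: limr_le; [apply: cvgP ux|apply: nearW].
Qed.

Definition orthonormal_seq u := forall m n, ip (u m) (u n) = (m == n)%:R.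

(** Vectors outside [d] are zero: such families are the images of an
    orthonormal basis under partial isometries, spreads in particular. *)
Definition partial_orthonormal (d : pred nat) F :=
  forall m n, ip (F m) (F n) = ((m == n) && d m)%:R.

Lemma orthonormal_partial u :
  orthonormal_seq u -> partial_orthonormal xpredT u.
Proof. by move=> uo m n; rewrite uo andbT. Qed.

Lemma ip_suml (r : seq nat) c F y :
  ip (\sum_(k <- r) c k *: F k) y = \sum_(k <- r) c k * ip (F k) y.
Proof.
rewrite (linear_sumlz ip); apply: eq_bigr => k _; exact: linearZl_LR.
Qed.

Lemma partial_sum_coef (r : seq nat) d c F n : partial_orthonormal d F ->
  uniq r -> n \in r ->
  ip (\sum_(k <- r) c k *: F k) (F n) = c n * (d n)%:R.
Proof.
move=> Fo ur nr; rewrite ip_suml (bigD1_seq n)//= Fo eqxx big1 ?addr0//.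
by move=> k kn; rewrite Fo (negPf kn) mulr0.
Qed.

Lemma partial_sum_rnorm (r : seq nat) d c F : partial_orthonormal d F ->
  uniq r ->
  rnorm (\sum_(k <- r) c k *: F k) ^+ 2 = \sum_(k <- r) (d k)%:R * rnorm (c k) ^+ 2.
Proof.
move=> Fo; elim: r => [|k r IH] /=; first by rewrite !big_nil rnorm0 expr0n.
move=> /andP[kr ur]; rewrite !big_cons pythagoras ?IH//.
  congr (_ + _); rewrite rnormZ exprMn mulrC; congr (_ * _).
  by apply: (@complexI R); rewrite -ip_self Fo eqxx/= raddfMn.
rewrite linearZl_LR/= ipC ip_suml big1_seq ?rmorph0 ?mulr0// => j /andP[_ jr].
by rewrite Fo; case: eqP kr => [<-|]; rewrite ?jr ?mulr0.
Qed.

Lemma partial_sum_rnorm_le (r : seq nat) d c F : partial_orthonormal d F ->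
  uniq r ->
  rnorm (\sum_(k <- r) c k *: F k) ^+ 2 <= \sum_(k <- r) rnorm (c k) ^+ 2.
Proof.
move=> Fo ur; rewrite (partial_sum_rnorm c Fo)//; apply: ler_sum => k _.
by case: (d k); rewrite ?mul1r// mul0r sqr_ge0.
Qed.

(** Square-summable coefficients make the partial sums Cauchy, because the
    blocks between two partial sums obey Pythagoras. *)
Lemma riesz_fischer d c F : partial_orthonormal d F ->
  cvgn (series (fun n => rnorm (c n) ^+ 2)) ->
  cvgn (series (fun n => c n *: F n)).
Proof.
move=> Fo /cauchy_cvgP/cauchy_seriesP cc; apply: cauchy_rnorm_cvgn => e e0.
have [[A B] /= [[N1 _ N1P] [N2 _ N2P]] ABP] := cc _ (exprn_gt0 2 e0).
exists (maxn N1 N2) => m n Nm mn; rewrite sub_series_geq//.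
rewrite -ltr_sqr ?nnegrE ?rnorm_ge0 ?(ltW e0)//.
apply: le_lt_trans (partial_sum_rnorm_le c Fo (iota_uniq _ _)) _.
rewrite -[ltLHS]ger0_norm; last by apply: sumr_ge0 => k _; rewrite sqr_ge0.
apply: (ABP (m, n)); split => /=.
  by apply: N1P; rewrite /= (leq_trans _ Nm)// leq_maxl.
by apply: N2P; rewrite /= (leq_trans _ mn)// (leq_trans _ Nm)// leq_maxr.
Qed.

Lemma bessel u x n : orthonormal_seq u ->
  \sum_(0 <= k < n) rnorm (ip x (u k)) ^+ 2 <= rnorm x ^+ 2.
Proof.
move=> uo; have up := orthonormal_partial uo.
pose s := \sum_(0 <= k < n) ip x (u k) *: u k.
have -> : rnorm x ^+ 2 = rnorm (x - s) ^+ 2 + rnorm s ^+ 2.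
  rewrite -pythagoras ?subrK//; apply: ip_eq0C; rewrite ip_suml big_nat_cond big1//.
  move=> k /andP[kn _]; rewrite linearBr/=.
  rewrite (ipC x) (ipC s) (partial_sum_coef _ up) ?iota_uniq ?mem_index_iota//.
  by rewrite mulr1 subrr mulr0.
have -> : rnorm s ^+ 2 = \sum_(0 <= k < n) rnorm (ip x (u k)) ^+ 2.
  rewrite (partial_sum_rnorm _ up) ?iota_uniq//.
  by apply: eq_bigr => k _; rewrite mul1r.
by rewrite lerDr sqr_ge0.
Qed.

Lemma bessel_cvgn u x : orthonormal_seq u ->
  cvgn (series (fun n => rnorm (ip x (u n)) ^+ 2)).
Proof.
move=> uo; apply: nondecreasing_is_cvgn.
  by apply: nondecreasing_series => n _ _; exact: sqr_ge0.
by exists (rnorm x ^+ 2) => _ [n _ <-]; exact: bessel.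
Qed.

Lemma fourier_cvgn d u F x : orthonormal_seq u -> partial_orthonormal d F ->
  cvgn (series (fun n => ip x (u n) *: F n)).
Proof. by move=> uo Fo; apply: (riesz_fischer Fo); exact: bessel_cvgn. Qed.

Lemma ip_series_coef u c x n : orthonormal_seq u ->
  series (fun n => c n *: u n) @ \oo --> x -> ip x (u n) = c n.
Proof.
move=> uo cx; apply: near_ip_lim cx _.
exists n.+1 => // m /= nm; rewrite (partial_sum_coef _ (orthonormal_partial uo)).
- by rewrite mulr1.
- exact: iota_uniq.
- by rewrite mem_index_iota.
Qed.

(** The Fourier series converges by Bessel's inequality and Riesz-Fischer, and
    its sum has the same coefficients as [x]. *)
Lemma fourier_projection u x : orthonormal_seq u ->
  exists2 p, series (fun n => ip x (u n) *: u n) @ \oo --> p &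
    forall n, ip (x - p) (u n) = 0.
Proof.
move=> uo; have /cvg_ex[p px] := @fourier_cvgn xpredT u u x uo (orthonormal_partial uo).
exists p => // n.
by rewrite linearBl/= (ip_series_coef n uo px) subrr.
Qed.

(** Compare [x] with a nearby [y] of the dense set: the square of the norm of
    [x] equals the inner product of [x] with [x - y]. *)
Lemma dense_ip_eq0 (D : set H) x : dense D -> (forall y, D y -> ip x y = 0) ->
  x = 0.
Proof.
move=> Dd xD; apply/eqP; rewrite -rnorm_eq0; apply/eqP/le_anti.
rewrite rnorm_ge0 andbT; apply/ler_addgt0Pr => d d0; rewrite add0r.
have dC : 0 < d%:C by rewrite ltcR.
have [|y [/= xy Dy]] := Dd (ball x d%:C) _ (ball_open x d%:C).
  by exists x; exact: ballxx.
have {}xy : rnorm (x - y) < d.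
  by move: xy; rewrite -ball_normE/= -rnormE ltcR.
have [->|x0] := eqVneq x 0; first by rewrite rnorm0 ltW.
apply: le_trans (ltW xy); have xp : 0 < rnorm x by rewrite rnorm_gt0.
rewrite -(ler_pM2l xp) -expr2 -[leLHS]ger0_norm ?sqr_ge0// -rnorm_real -ip_self.
by rewrite -[ip x x]subr0 -(xD _ Dy) -linearBr cauchy_schwarz.
Qed.

Lemma onb_total e x : is_onb ip e -> (forall n, ip x (e n) = 0) -> x = 0.
Proof.
move=> [_ ed] xe; apply: (dense_ip_eq0 ed) => y [n [c ->]].
by apply: ip_eq0C; rewrite (linear_sumlz ip) big1// => k _; rewrite linearZl_LR/=
  (ip_eq0C (xe k)) mulr0.
Qed.

Lemma total_expansion e x : orthonormal_seq e ->
  (forall y, (forall n, ip y (e n) = 0) -> y = 0) ->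
  series (fun n => ip x (e n) *: e n) @ \oo --> x.
Proof.
move=> eo et; have [p sp xp] := fourier_projection x eo.
by have /eqP := et _ xp; rewrite subr_eq0 => /eqP {2}->.
Qed.

Lemma onb_expansion e x : is_onb ip e ->
  series (fun n => ip x (e n) *: e n) @ \oo --> x.
Proof.
by move=> eb; apply: total_expansion (proj1 eb) _ => y; exact: onb_total.
Qed.

Lemma total_onb e : orthonormal_seq e ->
  (forall y, (forall n, ip y (e n) = 0) -> y = 0) -> is_onb ip e.
Proof.
move=> eo et; split=> // O [x Ox] Oo.
have /(_ O (open_nbhs_nbhs (conj Oo Ox))) := @total_expansion e x eo et.
move=> [N _ /(_ N (leqnn N))] /= ON.
exists (series (fun n => ip x (e n) *: e n) N); split=> //.
by exists N, (fun n => ip x (e n)); rewrite /series/= big_mkord.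
Qed.

End InnerProduct.

(** * Operators defined on an orthonormal basis *)

Section BasisOperators.
Context {R : realType} {H : completeNormedModType R[i]}.
Variable ip : {dot H for Num.conj}.
Hypothesis ip_norm : norm_induced_by ip.
Variable e : nat -> H.
Hypothesis e_onb : is_onb ip e.
Implicit Types (x y : H) (F : nat -> H) (d : pred nat).

(** Bessel's inequality bounds the partial sums of the series defining [L] by
    [rnorm x], so [L] is a contraction. *)
Lemma basis_operator d F : partial_orthonormal ip d F ->
  exists L : {linear H -> H}, [/\ continuous L,
    (forall x, rnorm (L x) <= rnorm x), (forall n, L (e n) = F n) &
    (forall x, series (fun n => ip x (e n) *: F n) @ \oo --> L x)].
Proof.
move=> Fo; have eo : orthonormal_seq ip e by case: e_onb.
pose s x := series (fun n => ip x (e n) *: F n).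
have slim : forall x, exists l : H, s x @ \oo --> l.
  by move=> x; have /cvg_ex := fourier_cvgn ip_norm (x := x) eo Fo.
have [L Ls] := choice slim.
have Llin : linear L.
  move=> a x y; apply: cvgn_uniq (Ls (a *: x + y)) _.
  have -> : s (a *: x + y) = (fun n => a *: s x n) + s y.
    apply/funext => n; rewrite /s /series/= fctE scaler_sumr -big_split/=.
    by apply: eq_bigr => k _; rewrite linearDl linearZl_LR/= scalerDl scalerA.
  by apply: cvgD => //; exact: cvgZl_tmp.
pose Ll : {linear H -> H} := HB.pack L (GRing.isLinear.Build _ _ _ _ L Llin).
have L1 x : rnorm (L x) <= rnorm x.
  apply: rnorm_lim_le (Ls x) _ => n.
  rewrite -ler_sqr ?nnegrE ?rnorm_ge0// (le_trans _ (bessel ip_norm x n eo))//.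
  exact: (partial_sum_rnorm_le ip_norm _ Fo (iota_uniq _ _)).
exists Ll; split=> //.
  by apply: (@rnorm_lipschitz_continuous _ _ _ _ 1) => x; rewrite mul1r.
move=> n; apply: cvgn_uniq (Ls (e n)) _.
apply: (@cvg_trans _ ((fun=> F n) @ \oo)); last exact: cvg_cst.
apply: near_eq_cvg; exists n.+1 => // m /= nm.
rewrite /s /series/= (bigD1_seq n) ?mem_index_iota ?iota_uniq//=.
rewrite eo eqxx scale1r big1 ?addr0// => k /negPf kn.
by rewrite eo eq_sym kn scale0r.
Qed.

Lemma basis_operator_ext (L1 L2 : {linear H -> H}) :
  continuous L1 -> continuous L2 -> (forall n, L1 (e n) = L2 (e n)) -> L1 =1 L2.
Proof.
move=> c1 c2 L12 x; have sx := onb_expansion ip_norm (x := x) e_onb.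
apply: cvgn_uniq (cvgn_linear c1 sx) _.
rewrite (_ : (fun n => _) = (fun n => L2 (series (fun k => ip x (e k) *: e k) n))).
  exact: cvgn_linear.
apply/funext => n; rewrite !linear_series; apply: eq_bigr => k _.
by rewrite !linearZ/= L12.
Qed.

End BasisOperators.

(** * Permutations of a basis as sums of spreads *)

Section Enumeration.
Implicit Types (A : set nat) (n : nat).

Lemma eqn_odd_half m n : (m == n) = (odd m == odd n) && (m./2 == n./2).
Proof.
apply/eqP/andP => [->//|[/eqP om /eqP hm]].
by rewrite -(odd_double_half m) om hm odd_double_half.
Qed.

Lemma unbounded_infinite A :
  (forall N, exists n, (N <= n)%N /\ A n) -> infinite_set A.
Proof.
move=> An /finite_seqP[s As]; have [n [sn An']] := An (\max_(x <- s) x).+1.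
move: An'; rewrite As/= => ns; move: sn; rewrite ltnNge; apply/negP/negPn.
by apply: leq_bigmax_seq.
Qed.

Lemma infinite_unbounded A :
  infinite_set A -> forall N, exists n, (N <= n)%N /\ A n.
Proof.
move=> Ai N; apply: contrapT => nA; apply: Ai.
apply: (@sub_finite_set _ _ `I_N); last exact: finite_II.
move=> n An /=; rewrite ltnNge; apply/negP => Nn; apply: nA.
by exists n.
Qed.

Lemma infinite_enumeration A : infinite_set A ->
  exists a, increasing_enumeration A a.
Proof.
move=> /infinite_unbounded Ai.
have nextA N : exists n, [/\ (N <= n)%N, A n &
    forall m, (N <= m)%N -> A m -> (n <= m)%N].
  have exN : exists n, (N <= n)%N && `[< A n >].
    by have [n [Nn An]] := Ai N; exists n; rewrite Nn; apply/asboolP.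
  case: (ex_minnP exN) => n /andP[Nn /asboolP An] nmin.
  by exists n; split=> // m Nm Am; apply: nmin; rewrite Nm; apply/asboolP.
have [f fP] := choice nextA.
pose a := fix a k := if k is k'.+1 then f (a k').+1 else f 0%N.
have Aa k : A (a k) by case: k => [|k] /=; [case: (fP 0%N)|case: (fP (a k).+1)].
have a_incr k : (a k < a k.+1)%N by rewrite /=; case: (fP (a k).+1).
have a_ge k : (k <= a k)%N.
  by elim: k => // k IH; exact: leq_ltn_trans IH (a_incr k).
exists a; split=> //; apply/seteqP; split=> [_ [k _ <-]//|m Am].
apply: contrapT => nma.
have am k : (a k < m)%N.
  elim: k => [|k IH]; rewrite ltn_neqAle; apply/andP; split.
  - by apply/eqP => am; apply: nma; exists 0%N.
  - by case: (fP 0%N) => _ _; exact.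
  - by apply/eqP => am; apply: nma; exists k.+1.
  - by case: (fP (a k).+1) => _ _; exact.
by have := leq_ltn_trans (a_ge m) (am m); rewrite ltnn.
Qed.

(** The records of [p] (positions whose value exceeds all earlier ones) can
    join any class without spoiling monotonicity, so the [r]-th record gets colour
    [logn 2 r.+1], which takes every value infinitely often.  A position [n]
    that is not a record opens its own class [n]; since every [m] has colour
    at most [m], no earlier position is in that class. *)
Lemma increasing_coloring (p q : nat -> nat) : cancel q p ->
  exists c : nat -> nat, (forall j, infinite_set [set n | c n = j]) /\
    (forall m n, (m < n)%N -> c m = c n -> (p m < p n)%N).
Proof.
move=> qK.
pose rcd n := [forall m : 'I_n, (p m < p n)%N].
pose rk n := (\sum_(0 <= m < n) rcd m)%N.
have rkS n : rk n.+1 = (rk n + rcd n)%N by rewrite /rk big_nat_recr.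
have rk_le n : (rk n <= n)%N.
  elim: n => [|n IH]; first by rewrite /rk big_geq.
  by rewrite rkS -addn1 leq_add// leq_b1.
pose c n := if rcd n then logn 2 (rk n).+1 else n.
have c_le n : (c n <= n)%N.
  rewrite /c; case: ifP => // _; apply: leq_trans (rk_le n).
  by rewrite -ltnS ltn_logl.
have rcdP N : exists2 n, (N <= n)%N & rcd n.
  pose M := \max_(k < N) p k.
  have exM : exists n, (M < p n)%N by exists (q M.+1); rewrite qK.
  case: (ex_minnP exM) => n Mn nmin; exists n.
    rewrite leqNgt; apply/negP => nN; move: Mn; rewrite ltnNge; apply/negP/negPn.
    exact: (leq_bigmax (Ordinal nN)).
  apply/forallP => m; apply: leq_ltn_trans Mn; rewrite leqNgt; apply/negP.
  by move=> /nmin; rewrite leqNgt ltn_ord.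
have rk_unbounded r : exists n, (r < rk n)%N.
  elim: r => [|r [n rn]].
    have [n _ nr] := rcdP 0%N; exists n.+1.
    by rewrite rkS nr addn1.
  have [m nm mr] := rcdP n; exists m.+1; rewrite rkS mr addn1 ltnS.
  by apply: leq_trans rn _; rewrite /rk [leqRHS](big_cat_nat (n := n))//= leq_addr.
have rk_onto r : exists2 n, rcd n & rk n = r.
  case: (ex_minnP (rk_unbounded r)) => -[|n]; first by rewrite /rk big_geq.
  move=> rn nmin; exists n.
    by case: (boolP (rcd n)) rn => // /negPf nr; rewrite rkS nr addn0 => /nmin;
      rewrite ltnn.
  have : (rk n <= r)%N by rewrite leqNgt; apply/negP => /nmin; rewrite ltnn.
  by move: rn; rewrite rkS; case: (rcd n) => /=; lia.
exists c; split=> [j|m n mn].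
  apply: unbounded_infinite => N.
  have [n nr rn] := rk_onto (2 ^ j * N.*2.+1).-1%N.
  have pos : (0 < 2 ^ j * N.*2.+1)%N by rewrite muln_gt0 expn_gt0.
  exists n; split.
    apply: leq_trans (rk_le n); rewrite rn.
    have : (N.*2.+1 <= 2 ^ j * N.*2.+1)%N by rewrite leq_pmull// expn_gt0.
    by lia.
  rewrite /= /c nr rn prednK// lognM ?expn_gt0// pfactorK// lognE.
  by rewrite /= dvdn2 /= odd_double/= addn0.
rewrite [c n]/c; case: ifPn => [/forallP/(_ (Ordinal mn))//|_ cmn].
by have := c_le m; rewrite cmn leqNgt mn.
Qed.

End Enumeration.

Section PermutationOperators.
Context {R : realType} {H : completeNormedModType R[i]}.
Variable ip : {dot H for Num.conj}.
Hypothesis ip_norm : norm_induced_by ip.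
Variable e : nat -> H.
Hypothesis e_onb : is_onb ip e.
Variables p q : nat -> nat.
Hypotheses (pK : cancel p q) (qK : cancel q p).

Let eo : orthonormal_seq ip e. Proof. by case: e_onb. Qed.

Lemma permuted_orthonormal (d : pred nat) (r : nat -> nat) : injective r ->
  partial_orthonormal ip d (fun n => if d n then e (r n) else 0).
Proof.
move=> r_inj m n; case: ifPn => dm; last by rewrite linear0l andbF.
rewrite andbT; case: ifPn => dn; first by rewrite eo (inj_eq r_inj).
by rewrite linear0r; case: eqP dm dn => // -> ->.
Qed.

(** Each class of an increasing colouring of [p] supports one spread. Their
    partial sums [L N] are contractions that agree with [U] on any given finite
    set of basis vectors from some point on, hence the strong convergence. *)
Theorem permutation_unitary_spread :
  exists2 U : {linear H -> H}, unitary_spread ip U & forall n, U (e n) = e (p n).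
Proof.
have p_inj := can_inj pK; have q_inj := can_inj qK.
have [c [c_inf c_incr]] := increasing_coloring qK.
have [U [Uc U1 Ue Us]] := basis_operator ip_norm e_onb
  (permuted_orthonormal predT p_inj).
have [V [Vc V1 Ve Vs]] := basis_operator ip_norm e_onb
  (permuted_orthonormal predT q_inj).
have [S SP] := choice (fun j => basis_operator ip_norm e_onb
  (permuted_orthonormal (fun n => c n == j) p_inj)).
have [L LP] := choice (fun j => basis_operator ip_norm e_onb
  (permuted_orthonormal (fun n => (c n < j)%N) p_inj)).
have SL N x : series (fun j => S j x) N = L N x.
  elim: N => [|N IH].
    have [_ _ _ L0] := LP 0%N; apply/esym/(cvgn_uniq (L0 x)).
    rewrite /series/= big_geq//.
    apply: (@cvg_trans _ ((fun=> 0) @ \oo)); last exact: cvg_cst.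
    by apply: near_eq_cvg; near=> n; rewrite /series/= big1// => k _; rewrite scaler0.
  have [_ _ _ LN] := LP N; have [_ _ _ LN1] := LP N.+1; have [_ _ _ SN] := SP N.
  rewrite seriesSr IH; apply: cvgn_uniq (LN1 x).
  rewrite [X in X @ \oo --> _](_ : _ =
    (series (fun n => ip x (e n) *: (if (c n < N)%N then e (p n) else 0)) : nat -> H) +
    (series (fun n => ip x (e n) *: (if c n == N then e (p n) else 0)) : nat -> H)).
    exact: cvgD.
  apply/funext => n; rewrite fctE /series/= -big_split/=; apply: eq_bigr => k _.
  by rewrite -scalerDr ltnS leq_eqVlt; case: ltngtP; rewrite ?addr0 ?add0r.
have LU x : (fun N => L N x) @ \oo --> U x.
  apply/cvg_rnormP/cvgrPdist_lt => d d0.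
  have /cvg_rnormP/cvgrPdist_lt/(_ _ (divr_gt0 d0 (ltr0n R 2))) :=
    onb_expansion ip_norm (x := x) e_onb.
  move=> /filter_ex[K]; set s := series _ K.
  rewrite sub0r normrN ger0_norm ?rnorm_ge0// => sx.
  exists (\max_(k < K) c k).+1 => // N /= KN.
  rewrite sub0r normrN ger0_norm ?rnorm_ge0//.
  have [_ LN1 LNe _] := LP N.
  have LUs : L N s = U s.
    rewrite /s !linear_series; apply: eq_big_nat => k /= kK; rewrite !linearZ/=.
    by rewrite LNe Ue (leq_ltn_trans _ KN)// (leq_bigmax (Ordinal kK)).
  rewrite (_ : L N x - U x = L N (x - s) + U (s - x)); last first.
    by rewrite !linearB/= LUs addrA subrK.
  rewrite (le_lt_trans (ler_rnormD _ _))//.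
  rewrite (le_lt_trans (lerD (LN1 _) (U1 _)))// [rnorm (x - s)]rnormB.
  by lra.
exists U; last by move=> n; rewrite Ue.
split=> //.
  exists V; split=> //.
  - move=> x y.
    have VE k : ip (e k) (V y) = ip (e (p k)) y.
      rewrite ipC [RHS]ipC; congr (_^*); rewrite -[k in LHS]pK.
      have eqo : orthonormal_seq ip (fun n => e (q n)).
        by move=> m n; rewrite eo (inj_eq q_inj).
      exact: (ip_series_coef ip_norm (p k) eqo (Vs y)).
    apply: (cvgn_uniq (ip_cvg ip_norm (y := y) (Us x))).
    rewrite (_ : (fun n => _) = (fun n => ip (series (fun k => ip x (e k) *: e k) n) (V y))).
      exact/ip_cvg/onb_expansion.
    apply/funext => n; rewrite !(ip_suml ip); apply: eq_bigr => k _.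
    by rewrite VE.
  - apply: (@basis_operator_ext _ _ _ ip_norm _ e_onb (V \o U) idfun) => [||n].
    + by move=> x; apply: continuous_comp; [exact: Uc|exact: Vc].
    + by move=> x; exact: cvg_id.
    + by rewrite /= Ue Ve/= pK.
  - apply: (@basis_operator_ext _ _ _ ip_norm _ e_onb (U \o V) idfun) => [||n].
    + by move=> x; apply: continuous_comp; [exact: Vc|exact: Uc].
    + by move=> x; exact: cvg_id.
    + by rewrite /= Ve Ue/= qK.
exists e, (fun j => [set n | c n = j]), (fun j => p @` [set n | c n = j]), S.
split=> //.
- move=> j; split; first exact: c_inf.
  move=> /(finite_image q); rewrite image_comp.
  rewrite (_ : q \o p = id) ?image_id; first exact: c_inf.
  by apply/funext => n /=; rewrite pK.
- move=> j; have [Sc _ Se _] := SP j; split=> //.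
  have [a [aA a_incr]] := infinite_enumeration (@c_inf j).
  have ca k : c (a k) = j.
    by have : range a (a k) by []; rewrite aA.
  exists a, (fun k => p (a k)); split=> //.
  + split; first by rewrite -aA image_comp.
    by move=> k; apply: c_incr => //; rewrite !ca.
  + by move=> n /eqP/negPf cn; rewrite Se/= cn.
  + by move=> k; rewrite Se/= ca eqxx.
- move=> x; rewrite (_ : series _ = (fun N => L N x)); first exact: LU.
  by apply/funext => N; rewrite SL.
Unshelve. all: by end_near. Qed.

End PermutationOperators.

(** * Closed subspaces and orthogonal projection *)

Section Projection.
Context {R : realType} {H : completeNormedModType R[i]}.
Variable ip : {dot H for Num.conj}.
Hypothesis ip_norm : norm_induced_by ip.
Implicit Types (x y z : H) (C : set H).

Definition subspace C := C 0 /\ forall (a : R[i]) x y, C x -> C y -> C (a *: x + y).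

Lemma subspaceD C x y : subspace C -> C x -> C y -> C (x + y).
Proof. by move=> [_ Cl] Cx Cy; rewrite -[x]scale1r; exact: Cl. Qed.

Lemma subspaceZ C (a : R[i]) x : subspace C -> C x -> C (a *: x).
Proof. by move=> [C0 Cl] Cx; rewrite -[_ *: _]addr0; exact: Cl. Qed.

Lemma subspaceB C x y : subspace C -> C x -> C y -> C (x - y).
Proof.
by move=> Cs Cx Cy; apply: subspaceD => //; rewrite -scaleN1r; exact: subspaceZ.
Qed.

Lemma parallelogram x y :
  rnorm (x + y) ^+ 2 + rnorm (x - y) ^+ 2 = 2 * (rnorm x ^+ 2 + rnorm y ^+ 2).
Proof.
apply: (@complexI R); rewrite rmorphM !rmorphD/= -!(ip_self ip_norm).
rewrite dnormD dnormB addrACA subrr addr0.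
by rewrite -mulr2n -mulr_natl.
Qed.

(** Minimising sequences for the distance to [C] are Cauchy by the
    parallelogram law, and the difference between [x] and a closest point [p]
    is orthogonal to [C], since otherwise moving [p] along [C] would come
    closer. *)
Theorem projection C x : subspace C -> closed C ->
  exists2 p, C p & forall c, C c -> ip (x - p) c = 0.
Proof.
move=> Cs Cc; pose E := [set rnorm (x - c) | c in C].
have E0 : E !=set0 by exists (rnorm (x - 0)), 0; case: Cs.
have Elb : has_lbound E by exists 0 => _ [c _ <-]; exact: rnorm_ge0.
pose d := inf E.
have dE c : C c -> d <= rnorm (x - c) by move=> Cx; apply: ge_inf => //; exists c.
have d0 : 0 <= d by apply: lb_le_inf => // _ [c _ <-]; exact: rnorm_ge0.
have close n : exists c, C c /\ rnorm (x - c) < d + n.+1%:R^-1.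
  have [||_ [c Cx <-] cd] := @inf_adherent _ E n.+1%:R^-1; first by rewrite invr_gt0.
    by split.
  by exists c.
have [c cP] := choice close.
have small (e : R) : 0 < e -> exists N, N.+1%:R^-1 < e :> R.
  by move=> e0; have [N _ /(_ N (leqnn N))] := near_infty_natSinv_lt (PosNum e0);
    exists N.
have /cvg_ex[p cp] : cvgn c.
  apply: cauchy_rnorm_cvgn => e e0.
  have k0 : 0 < 8 * d + 5 by lra.
  have [N Ne] := small (Order.min 1 (e ^+ 2 / (8 * d + 5)))
    ltac:(by rewrite lt_min ltr01 divr_gt0// exprn_gt0).
  exists N => m n Nm mn.
  set t := N.+1%:R^-1 : R; have t0 : 0 < t by rewrite invr_gt0.
  have ct k : (N <= k)%N -> rnorm (x - c k) < d + t.
    move=> Nk; have [_ /lt_le_trans->//] := cP k.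
    by rewrite lerD2l lef_pV2 ?posrE// ler_nat.
  move: Ne; rewrite lt_min -/t ltr_pdivlMr// => /andP[t1 te].
  have := parallelogram (x - c m) (x - c n).
  have -> : x - c m - (x - c n) = c n - c m by rewrite opprB addrC addrA subrK.
  have -> : x - c m + (x - c n) = 2 *: (x - 2^-1 *: (c m + c n)).
    rewrite scalerBr scalerA divff// scale1r scaler_nat mulr2n.
    by rewrite addrACA opprD.
  have rnorm2 : rnorm (2 : R[i]) = 2.
    by rewrite -(rmorph_nat (real_complex R) 2) rnorm_real ger0_norm.
  rewrite rnormZ rnorm2 => par.
  have mid : d <= rnorm (x - 2^-1 *: (c m + c n)).
    by apply: dE; apply: subspaceZ => //; apply: subspaceD => //; case: (cP m); case: (cP n).
  rewrite -ltr_sqr ?nnegrE ?rnorm_ge0 ?(ltW e0)//.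
  have := ct _ Nm; have := ct _ (leq_trans Nm mn); move: par mid.
  move: (rnorm_ge0 (x - c m)) (rnorm_ge0 (x - c n)).
  move: (rnorm (x - c m)) (rnorm (x - c n)) (rnorm (x - 2^-1 *: _)) (rnorm (c n - _)).
  move=> A B M D A0 B0 par mid Bt At.
  have : A ^+ 2 < (d + t) ^+ 2 by rewrite ltr_sqr ?nnegrE//; lra.
  have : B ^+ 2 < (d + t) ^+ 2 by rewrite ltr_sqr ?nnegrE//; lra.
  have : d ^+ 2 <= M ^+ 2 by rewrite ler_sqr ?nnegrE//; lra.
  have : t ^+ 2 <= t by rewrite expr2 ler_piMl// ltW.
  rewrite exprMn in par; rewrite sqrrD => *; nra.
have Cp : C p.
  by apply: (closed_cvg _ Cc _ _ cp); apply: nearW => n; case: (cP n).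
have pd : rnorm (x - p) <= d.
  suff pde (e : R) : 0 < e -> rnorm (x - p) <= d + e by apply/ler_addgt0Pr.
  move=> e0; have e2 : 0 < e / 2 by rewrite divr_gt0.
  have /cvg_rnormP/cvgrPdist_lt/(_ _ e2) [N2 _ N2P] := cp.
  have [N1 N1e] := small _ e2.
  have [n n1 n2] : exists2 n, (N1 <= n)%N & (N2 <= n)%N.
    by exists (maxn N1 N2); rewrite ?leq_maxl ?leq_maxr.
  have := N2P n n2; rewrite /= sub0r normrN ger0_norm ?rnorm_ge0// => cpe.
  have -> : x - p = (x - c n) + (c n - p) by rewrite addrA subrK.
  have [_ cn] := cP n.
  have nN1 : n.+1%:R^-1 <= N1.+1%:R^-1 :> R by rewrite lef_pV2 ?posrE// ler_nat ltnS.
  have := ler_rnormD (x - c n) (c n - p).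
  move: (n.+1%:R^-1) (N1.+1%:R^-1) N1e cn nN1 => r s rs cn sr.
  by lra.
exists p => // c' Cc'; have [->|c0] := eqVneq c' 0; first exact: linear0r.
have cc0 : ip c' c' != 0 by rewrite dnorm_eq0.
pose a := ip (x - p) c' / ip c' c'.
have ortho : ip (x - (p + a *: c')) (a *: c') = 0.
  rewrite linearZr_LR/= opprD addrA linearBl/= linearZl_LR/= divfK// subrr.
  by rewrite mulr0.
have /eqP := pythagoras ip_norm ortho.
have -> : x - (p + a *: c') + a *: c' = x - p by rewrite opprD addrA subrK.
move=> /eqP pyt.
have dle : d <= rnorm (x - (p + a *: c')).
  by apply: dE; rewrite addrC; apply: (proj2 Cs).
have : rnorm (a *: c') ^+ 2 <= 0.
  have : rnorm (x - p) ^+ 2 <= d ^+ 2 by rewrite ler_sqr ?nnegrE ?rnorm_ge0.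
  have : d ^+ 2 <= rnorm (x - (p + a *: c')) ^+ 2 by rewrite ler_sqr ?nnegrE ?rnorm_ge0.
  by move: pyt; lra.
rewrite le_eqVlt ltNge sqr_ge0 orbF sqrf_eq0 rnorm_eq0 scaler_eq0 (negPf c0) orbF.
by rewrite mulf_eq0 invr_eq0 (negPf cc0) orbF => /eqP.
Qed.

End Projection.

(** * Extending an orthonormal sequence to a basis *)

Section Extension.
Context {R : realType} {H : completeNormedModType R[i]}.
Variable ip : {dot H for Num.conj}.
Hypothesis ip_norm : norm_induced_by ip.
Implicit Types (x y z : H) (u e f : nat -> H) (Y : set H).

Definition orthocomplement Y : set H := [set z | forall y, Y y -> ip z y = 0].

Lemma orthocomplement_subspace Y : subspace (orthocomplement Y).
Proof.
split=> [y _|a x z xY zY y Yy]; first exact: linear0l.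
by rewrite linearDl linearZl_LR/= xY// zY// mulr0 addr0.
Qed.

Lemma orthocomplement_closed Y : closed (orthocomplement Y).
Proof.
move=> z zcl y Yy; apply/eqP; rewrite -rnorm_eq0; apply/eqP/le_anti.
rewrite rnorm_ge0 andbT.
suff zy (d : R) : 0 < d -> rnorm (ip z y) <= 0 + d by apply/ler_addgt0Pr.
move=> d0; rewrite add0r; have y1 : 0 < rnorm y + 1 by rewrite ltr_wpDl ?rnorm_ge0.
have r0 : 0 < d / (rnorm y + 1) by rewrite divr_gt0.
have rC : 0 < (d / (rnorm y + 1))%:C by rewrite ltcR.
have [z' [z'Y]] := zcl _ (nbhsx_ballx z _ rC).
rewrite -ball_normE/= -rnormE ltcR => zz'.
rewrite -[ip z y]subr0 -(z'Y _ Yy) -linearBl/=.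
rewrite (le_trans (cauchy_schwarz ip_norm _ _))//.
rewrite (le_trans (ler_wpM2r (rnorm_ge0 _) (ltW zz')))//.
rewrite -[leRHS](@divfK _ (rnorm y + 1)) ?gt_eqF// ler_wpM2l ?lerDl// ltW//.
Qed.

(** Gram-Schmidt relative to [u]: the [n]-th term of a total sequence [f] is
    replaced by its component orthogonal to [u] and to the earlier terms. The
    closed span of these is taken as a double orthogonal complement, so no
    recursion is needed. Some components vanish, hence the final
    re-enumeration. *)
Lemma onb_extension f u : is_onb ip f -> orthonormal_seq ip u ->
  exists e (j : nat -> nat), is_onb ip e /\ forall n, e (j n) = u n.
Proof.
move=> f_onb uo.
pose Y n : set H :=
  [set y | (forall m, ip y (u m) = 0) /\ forall i, (i < n)%N -> ip y (f i) = 0].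
pose C n := orthocomplement (Y n).
have Cs n : subspace (C n) by exact: orthocomplement_subspace.
have Cu n m : C n (u m) by move=> y [yu _]; exact: ip_eq0C.
have Cf n i : (i < n)%N -> C n (f i) by move=> lt_in y [_ yf]; exact/ip_eq0C/yf.
have CS m n : (m <= n)%N -> C m `<=` C n.
  move=> mn z Cz y [yu yf]; apply: Cz; split=> // i im.
  exact/yf/(leq_trans im).
have proj n : exists w, C n (f n - w) /\ forall c, C n c -> ip w c = 0.
  have [p Cp fp] := projection ip_norm (f n) (Cs n) (@orthocomplement_closed _).
  by exists (f n - p); rewrite subKr.
have [w wP] := choice proj.
have wC m n : (m < n)%N -> C n (w m).
  move=> mn; rewrite -[w m](subKr (f m)); apply: (subspaceB (Cs n)); first exact: Cf.
  by case: (wP m) => Cm _; apply: CS Cm; exact: ltnW.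
have ww m n : m != n -> ip (w m) (w n) = 0.
  case: ltngtP => // mn _; last by case: (wP m) => _ wm; exact/wm/wC.
  by apply: ip_eq0C; case: (wP n) => _ wn; exact/wn/wC.
have wu m n : ip (w m) (u n) = 0 by case: (wP m) => _ wm; exact: wm.
pose v n := (rnorm (w n))^-1%:C *: w n.
pose F m := if odd m then v m./2 else u m./2.
pose d m := odd m ==> (w m./2 != 0).
have Fo : partial_orthonormal ip d F.
  move=> m n; rewrite /F /d.
  rewrite eqn_odd_half; case: ifPn => om; case: ifPn => on //=.
  - have [mn|mn] := eqVneq m./2 n./2; last first.
      by rewrite linearZl_LR linearZr_LR/= ww// !mulr0.
    rewrite -mn; have [w0|w0] := eqVneq (w m./2) 0.
      by rewrite /v w0 scaler0 linear0l.
    by apply: rnorm_unit; rewrite // rnorm_normalize.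
  - by rewrite linearZl_LR/= wu mulr0.
  - by rewrite linearZr_LR/= (ip_eq0C (wu _ _)) mulr0.
  - by rewrite uo andbT.
have dinf : infinite_set [set m | d m].
  apply: unbounded_infinite => N; exists N.*2.
  by split; [rewrite -addnn leq_addr|rewrite /= /d odd_double].
have [a [aE a_incr]] := infinite_enumeration dinf.
have a_inj : injective a.
  have alt m n : (m < n)%N -> (a m < a n)%N.
    elim: n => // n IH; rewrite ltnS leq_eqVlt => /orP[/eqP->//|/IH mn].
    exact: ltn_trans mn (a_incr n).
  by move=> m n amn; case: (ltngtP m n) => // /alt; rewrite amn ltnn.
have onJ m : d m -> exists k, a k = m.
  by move=> dm; have : [set m | d m] m by []; rewrite -aE => -[k _ <-]; exists k.
have da k : d (a k) by have : range a (a k) by []; rewrite aE.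
have ju n : exists k, a k = n.*2 by apply: onJ; rewrite /d odd_double.
have [j jP] := choice ju.
exists (fun k => F (a k)), j; split; last first.
  by move=> n; rewrite jP /F odd_double doubleK.
apply: total_onb => // [m n|x xF]; first by rewrite Fo (inj_eq a_inj) da andbT.
have {}xF m : d m -> ip x (F m) = 0 by move=> /onJ[k <-].
have xu n : ip x (u n) = 0.
  by have := xF n.*2; rewrite /d /F odd_double doubleK; apply.
have xw n : ip x (w n) = 0.
  have [->|w0] := eqVneq (w n) 0; first exact: linear0r.
  have := xF n.*2.+1; rewrite /d /F/= odd_double/= uphalf_double w0 => /(_ isT).
  rewrite linearZr_LR/= => /eqP; rewrite mulf_eq0 conjC_eq0 => /orP[|/eqP//].
  by rewrite (inj_eq (@complexI R) _ 0) invr_eq0 rnorm_eq0 (negPf w0).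
apply: (onb_total ip_norm f_onb) => n; elim/ltn_ind: n => n IH.
rewrite -[f n](subrK (w n)) linearDr/= xw addr0; apply: ip_eq0C.
by case: (wP n) => fw _; apply: fw; split.
Qed.

Lemma orthonormal_permutation_spread f u (t t' : nat -> nat) :
  is_onb ip f -> orthonormal_seq ip u -> cancel t t' -> cancel t' t ->
  exists2 U : {linear H -> H}, unitary_spread ip U & forall n, U (u n) = u (t n).
Proof.
move=> f_onb uo tK t'K; have [e [j [e_onb eu]]] := onb_extension f_onb uo.
have j_inj : injective j.
  move=> m n jmn; have := uo m n; rewrite -!eu jmn (proj1 e_onb) eqxx.
  by case: eqP => // _ /eqP; rewrite oner_eq0.
have ext (s : nat -> nat) : exists p : nat -> nat, (forall n, p (j n) = j (s n)) /\
    forall k, (forall n, k <> j n) -> p k = k.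
  have pP k : exists r, (forall n, k = j n -> r = j (s n)) /\
      ((forall n, k <> j n) -> r = k).
    have [[n ->]|kj] := pselect (exists n, k = j n).
      by exists (j (s n)); split=> [m /j_inj->//|/(_ n)].
    by exists k; split=> // n kn; case: kj; exists n.
  by have [p pr] := choice pP; exists p; split=> [n|k]; [exact: (proj1 (pr _))|
    exact: (proj2 (pr _))].
have [p [pj pN]] := ext t; have [q [qj qN]] := ext t'.
have canc : cancel p q /\ cancel q p.
  split=> k; have [[n ->]|kj] := pselect (exists n, k = j n);
    rewrite ?pj ?qj ?pj ?tK ?t'K// !(pN, qN)// => n kn; case: kj; by exists n.
have [U Us Ue] := permutation_unitary_spread ip_norm e_onb (proj1 canc) (proj2 canc).
by exists U => // n; rewrite -!eu Ue pj.
Qed.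

End Extension.

(** * Eigenvalues in the Schauder spectrum and bilateral shifts *)

Section Eigenvectors.
Context {R : realType} {H : completeNormedModType R[i]}.
Variable ip : {dot H for Num.conj}.
Hypothesis ip_norm : norm_induced_by ip.
Implicit Types (x y z : H) (e f a b : nat -> H) (T : {linear H -> H}).

(** Both norms are the limits of the same sums of squares. *)
Lemma same_coef_rnorm e f x y : is_onb ip e -> is_onb ip f ->
  (forall n, ip x (e n) = ip y (f n)) -> rnorm x = rnorm y.
Proof.
move=> eb fb xy.
have /cvg_rnorm ex := onb_expansion ip_norm (x := x) eb.
have /cvg_rnorm fy := onb_expansion ip_norm (x := y) fb.
have eo := orthonormal_partial (proj1 eb); have fo := orthonormal_partial (proj1 fb).
have exy : (fun n => rnorm (series (fun n => ip x (e n) *: e n) n)) =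
           (fun n => rnorm (series (fun n => ip y (f n) *: f n) n)).
  apply/funext => n; apply/eqP; rewrite -(@eqrXn2 _ 2) ?rnorm_ge0//; apply/eqP.
  rewrite (partial_sum_rnorm ip_norm _ eo) ?iota_uniq//.
  rewrite (partial_sum_rnorm ip_norm _ fo) ?iota_uniq//.
  by apply: eq_bigr => k _; rewrite xy.
rewrite exy in ex.
by rewrite -(cvg_lim (@Rhausdorff R) ex) -(cvg_lim (@Rhausdorff R) fy).
Qed.

(** If the columns of [l - T] were a Schauder basis [f], up to a unitary, the
    coordinates of an eigenvector [x] would expand [0] along [f], and
    uniqueness of expansions would kill them. *)
Lemma eigenvalue_schauder_spectrum T (l : R[i]) x : continuous T ->
  x != 0 -> T x = l *: x -> schauder_spectrum ip T l.
Proof.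
move=> Tc x0 Tx [e eb [g [f [gb fb eqM]]]].
pose s := series (fun n => ip x (e n) *: e n).
pose z := series (fun n => ip x (e n) *: f n).
have sx : s @ \oo --> x by exact: onb_expansion.
have zs n : rnorm (z n) = rnorm (l *: s n - T (s n)).
  apply: (same_coef_rnorm gb eb) => m.
  rewrite /z /s (linear_series T) /series/= scaler_sumr -sumrB.
  rewrite ip_suml (linear_sumlz ip); apply: eq_bigr => k _.
  rewrite [T _]linearZ/= scalerA (mulrC l) -scalerA -scalerBr linearZl_LR/=; congr (_ * _).
  by have /(congr1 (fun M => M m k)) := eqM; rewrite /operator_matrix /coefficient_matrix/=.
have z0 : z @ \oo --> (0 : H).
  apply/norm_cvg0P; rewrite (_ : (fun n => _) = (fun n => `|l *: s n - T (s n)|)).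
    apply/norm_cvg0P; rewrite -(subrr (l *: x)) -{2}Tx.
    by apply: cvgB; [exact: cvgZl_tmp|exact: cvgn_linear].
  by apply/funext => n; rewrite -!rnormE zs.
have [c [_ cU]] := fb 0.
have c0 : c = (fun=> 0).
  apply: cU; rewrite (_ : series _ = fun=> 0); first exact: cvg_cst.
  by apply/funext => n; rewrite /series/= big1// => k _; rewrite scale0r.
have xc : c = (fun n => ip x (e n)) by exact: cU.
move/eqP: x0; apply; apply: (onb_total ip_norm eb) => n.
by rewrite -[LHS]/((fun n => ip x (e n)) n) -xc c0.
Qed.

Lemma rnorm_prod n (F : 'I_n -> R[i]) :
  rnorm (\prod_(k < n) F k) = \prod_(k < n) rnorm (F k).
Proof.
by apply: (big_morph (fun z : R[i] => rnorm z) (@rnormM R)); rewrite /rnorm normr1.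
Qed.

(** An eigenvector of a bilateral weighted shift
      [... b 1 -> b 0 -> a 0 -> a 1 -> ...]
    is found by solving the recursion for its coefficients, starting with
    coefficient 1 at [a 0]; the two hypotheses say that the solution is square
    summable in both directions. *)
Lemma bilateral_shift_eigenvector T (a b : nat -> H) (w v : nat -> R) (l : R[i])
    (rho : R) : continuous T ->
  orthonormal_seq ip a -> orthonormal_seq ip b ->
  (forall m n, ip (b m) (a n) = 0) ->
  (forall n, T (a n) = (w n)%:C *: a n.+1) ->
  T (b 0%N) = (v 0%N)%:C *: a 0%N ->
  (forall n, T (b n.+1) = (v n.+1)%:C *: b n) ->
  0 < rho -> rnorm l = rho -> (forall n, v n != 0) ->
  cvgn (series (fun n => \prod_(k < n.+1) (w k / rho) ^+ 2)) ->
  cvgn (series (fun n => \prod_(k < n.+1) (rho / v k) ^+ 2)) ->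
  exists2 x, x != 0 & T x = l *: x.
Proof.
move=> Tc ao bo ba Ta Tb0 Tb rho0 lrho v0 wcv vcv.
have l0 : l != 0 by rewrite -rnorm_eq0 lrho gt_eqF.
pose c n := \prod_(k < n) ((w k)%:C / l).
pose d n := \prod_(k < n.+1) (l / (v k)%:C).
have cS n : l * c n.+1 = (w n)%:C * c n.
  by rewrite /c big_ord_recr/= mulrC -mulrA divfK// mulrC.
have vC n : (v n)%:C != 0 :> R[i] by rewrite (inj_eq (@complexI R) _ 0).
have d0 : d 0%N * (v 0%N)%:C = l by rewrite /d big_ord1 divfK.
have dS n : d n.+1 * (v n.+1)%:C = l * d n.
  by rewrite /d big_ord_recr/= -mulrA divfK// mulrC.
pose X := series (fun n => c n.+1 *: a n.+1).
pose Y := series (fun n => d n *: b n).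
have /cvg_ex[x Xx] : cvgn X.
  apply: (@riesz_fischer _ _ _ ip_norm predT (fun n => c n.+1) (fun n => a n.+1)).
    by move=> m n; rewrite ao eqSS andbT.
  rewrite (_ : (fun n => _) = (fun n => \prod_(k < n.+1) (w k / rho) ^+ 2))//.
  apply/funext => n; rewrite /c rnorm_prod.
  rewrite -prodrXl; apply: eq_bigr => k _.
  by rewrite rnormM rnormV rnorm_real lrho !exprMn real_normK ?num_real.
have /cvg_ex[y Yy] : cvgn Y.
  apply: (@riesz_fischer _ _ _ ip_norm predT d b).
    exact: orthonormal_partial.
  rewrite (_ : (fun n => _) = (fun n => \prod_(k < n.+1) (rho / v k) ^+ 2))//.
  apply/funext => n; rewrite /d rnorm_prod.
  rewrite -prodrXl; apply: eq_bigr => k _.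
  by rewrite rnormM rnormV rnorm_real lrho !exprMn !exprVn real_normK ?num_real.
have TX : T x = l *: (x - c 1%N *: a 1%N).
  apply: cvgn_uniq (cvgn_linear Tc Xx) _.
  rewrite (_ : (fun n => _) = (fun n => l *: (X n.+1 - c 1%N *: a 1%N))).
    apply: cvgZl_tmp; apply: cvgB; last exact: cvg_cst.
    by have := Xx; rewrite -cvg_shiftS; exact.
  apply/funext => n; rewrite linear_series /X /series/= big_nat_recl// addrC addKr.
  rewrite scaler_sumr; apply: eq_bigr => k _.
  by rewrite linearZ/= Ta !scalerA mulrC -cS.
have TY : T y = l *: (a 0%N + y).
  have YS : (fun n => T (Y n.+1)) @ \oo --> T y.
    by apply: cvgn_linear => //; have := Yy; rewrite -cvg_shiftS; exact.
  apply: cvgn_uniq YS _.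
  rewrite (_ : (fun n => _) = (fun n => l *: (a 0%N + Y n))).
    by apply: cvgZl_tmp; apply: cvgD => //; exact: cvg_cst.
  apply/funext => n; rewrite linear_series /Y /series/= big_nat_recl// linearZ/=.
  rewrite Tb0 scalerA d0 scalerDr; congr (_ + _); rewrite scaler_sumr.
  by apply: eq_bigr => k _; rewrite linearZ/= Tb !scalerA dS.
exists (a 0%N + x + y); last first.
  rewrite !linearD/= TX TY Ta scalerBr scalerA cS /c big_ord0 mulr1.
  by rewrite addrCA subrr addr0 scalerDr addrA (addrC (l *: x)).
apply/eqP => /(congr1 (fun z => ip z (a 0%N))).
rewrite linear0l !linearDl/= ao eqxx.
have -> : ip x (a 0%N) = 0.
  apply: (ip_lim_eq0 ip_norm Xx) => n; rewrite ip_suml big1// => k _.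
  by rewrite ao mulr0.
have -> : ip y (a 0%N) = 0.
  apply: (ip_lim_eq0 ip_norm Yy) => n; rewrite ip_suml big1// => k _.
  by rewrite ba mulr0.
by move/eqP; rewrite !addr0 oner_eq0.
Qed.

End Eigenvectors.

(** * Fredholm operators and singular vectors *)

Section Fredholm.
Context {R : realType} {H : completeNormedModType R[i]}.
Variable ip : {dot H for Num.conj}.
Hypothesis ip_norm : norm_induced_by ip.
Implicit Types (x y z : H) (V W C : set H) (L : seq H) (T : {linear H -> H}).

Definition add_line W v : set H := [set x | exists a y, W y /\ x = y + a *: v].

Definition orthogonal_part V L : set H :=
  [set x | V x /\ forall y, y \in L -> ip x y = 0].

Lemma setT_subspace : subspace [set: H].
Proof. by []. Qed.

Lemma orthogonal_part_subspace V L : subspace V -> subspace (orthogonal_part V L).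
Proof.
move=> Vs; split=> [|a x y [Vx xL] [Vy yL]].
  by split=> [|y _]; [case: Vs|exact: linear0l].
split=> [|z zL]; first by case: Vs => _; exact.
by rewrite linearDl linearZl_LR/= xL// yL// mulr0 addr0.
Qed.

(** A subspace is obtained from its part orthogonal to finitely many vectors by
    adding finitely many lines, so whatever survives adding a line passes from
    the orthogonal part to the whole subspace. *)
Lemma finite_codim_ind (P : set H -> Prop) :
  (forall W v, subspace W -> P W -> P (add_line W v)) ->
  forall L V, subspace V -> P (orthogonal_part V L) -> P V.
Proof.
move=> Pline; elim=> [|l L IH] V Vs PV.
  by rewrite (_ : V = orthogonal_part V [::])//; apply/seteqP; split=> x => [Vx|[]].
apply: (IH V Vs); set W := orthogonal_part V L.
have Ws : subspace W by exact: orthogonal_part_subspace.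
pose W' := orthogonal_part V (l :: L).
have W'E x : W' x <-> W x /\ ip x l = 0.
  split=> [[Vx xlL]|[[Vx xL] xl]].
    split; last by apply: xlL; rewrite mem_head.
    by split=> // y yL; apply: xlL; rewrite in_cons yL orbT.
  by split=> // y; rewrite in_cons => /orP[/eqP->//|]; exact: xL.
have [[v [Wv vl]]|nWl] := pselect (exists v, W v /\ ip v l != 0); last first.
  rewrite (_ : W = W')//; apply/seteqP; split=> x; last by move=> /W'E[].
  move=> Wx; apply/W'E; split=> //; apply/eqP/negPn/negP => xl.
  by apply: nWl; exists x.
rewrite (_ : W = add_line W' v).
  by apply: Pline => //; exact: orthogonal_part_subspace.
apply/seteqP; split=> [x Wx|_ [a [y [/W'E[Wy _] ->]]]]; last first.
  by apply: subspaceD => //; exact: subspaceZ.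
exists (ip x l / ip v l), (x - (ip x l / ip v l) *: v); split; last by rewrite subrK.
apply/W'E; split; first by apply: subspaceB => //; exact: subspaceZ.
by rewrite linearBl/= linearZl_LR/= divfK// subrr.
Qed.

Lemma finite_dim_add_line W v : finite_dim W -> finite_dim (add_line W v).
Proof.
move=> [n [u ->]]; pose u' i := if unlift ord0 i is Some j then u j else v.
exists n.+1, u'; apply/seteqP; split=> [_ [a [_ [[c ->] ->]]]|_ [c ->]].
  exists (fun i => if unlift ord0 i is Some j then c j else a).
  rewrite big_ord_recl /u' unlift_none addrC; congr (_ + _).
  by apply: eq_bigr => i _; rewrite liftK.
exists (c ord0), (\sum_(i < n) c (lift ord0 i) *: u i).
split; first by exists (fun i => c (lift ord0 i)).
rewrite big_ord_recl /u' unlift_none addrC; congr (_ + _).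
by apply: eq_bigr => i _; rewrite liftK.
Qed.

Lemma finite_dim0 : finite_dim [set 0 : H].
Proof.
exists 0%N, (fun=> 0); apply/seteqP; split=> [x ->|_ [c ->]].
  by exists (fun=> 0); rewrite big_ord0.
by rewrite big_ord0.
Qed.

(** Replacing the direction of the line by its component [w] orthogonal to the
    closed subspace [C], the sum is the preimage of [C] under the continuous
    projection along [w]. *)
Lemma closed_add_line C v : subspace C -> closed C -> closed (add_line C v).
Proof.
move=> Cs Cc; have [p Cp] := projection ip_norm v Cs Cc.
have [w ->] : exists w, v = p + w by exists (v - p); rewrite addrC subrK.
rewrite addrC addKr {v} => wC.
have [->|w0] := eqVneq w 0; rewrite ?addr0.
  rewrite (_ : add_line C p = C)//; apply/seteqP; split=> [_ [a [y [Cy ->]]]|x Cx].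
    by apply: subspaceD => //; exact: subspaceZ.
  by exists 0, x; rewrite scale0r addr0.
have ww0 : ip w w != 0 by rewrite dnorm_eq0.
pose G x := x - (ip x w / ip w w) *: w.
have Glin : linear G.
  move=> a x y; rewrite /G linearDl linearZl_LR/= mulrDl scalerDl opprD addrACA.
  by rewrite scalerBr scalerA mulrA.
pose Gl : {linear H -> H} := HB.pack G (GRing.isLinear.Build _ _ _ _ G Glin).
have Gc : continuous Gl.
  apply: (@rnorm_lipschitz_continuous _ _ _ _ 1) => x; rewrite mul1r.
  rewrite -ler_sqr ?nnegrE ?rnorm_ge0//.
  have /(pythagoras ip_norm) : ip (Gl x) ((ip x w / ip w w) *: w) = 0.
    by rewrite linearZr_LR/= /G linearBl/= linearZl_LR/= divfK// subrr mulr0.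
  by rewrite /= /G subrK => ->; rewrite lerDl sqr_ge0.
rewrite (_ : add_line C (p + w) = Gl @^-1` C).
  by apply: closed_comp => // x _; exact: Gc.
apply/seteqP; split=> [_ [a [y [Cy ->]]]|x /= CGx].
  rewrite scalerDr addrA /= /G linearDl linearZl_LR/= (ip_eq0C (wC _ _)); last first.
    by apply: subspaceD => //; exact: subspaceZ.
  by rewrite add0r mulfK// addrK; apply: subspaceD => //; exact: subspaceZ.
exists (ip x w / ip w w), (G x - (ip x w / ip w w) *: p); split.
  by apply: subspaceB => //; exact: subspaceZ.
by rewrite scalerDr addrA !subrK.
Qed.

Lemma range_subspace T V : subspace V -> subspace (T @` V).
Proof.
move=> Vs; split=> [|a _ _ [x Vx <-] [y Vy <-]].
  by exists 0; [case: Vs|rewrite linear0].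
by exists (a *: x + y); [case: Vs => _; exact|rewrite linearP].
Qed.

Lemma image_add_line T W v : T @` add_line W v = add_line (T @` W) (T v).
Proof.
apply/seteqP; split=> [_ [_ [a [y [Wy ->]]] <-]|_ [a [_ [[y Wy <-] ->]]]].
  by exists a, (T y); rewrite linearD linearZ; split=> //; exists y.
by exists (y + a *: v); [exists a, y|rewrite linearD linearZ].
Qed.

(** Approximate preimages of a point of the closure form a Cauchy sequence. *)
Lemma bounded_below_closed_range T V (e : R) : continuous T -> 0 < e ->
  subspace V -> closed V -> (forall x, V x -> e * rnorm x <= rnorm (T x)) ->
  closed (T @` V).
Proof.
move=> Tc e0 Vs Vc eT y ycl.
have near_y n : exists x, V x /\ rnorm (y - T x) < n.+1%:R^-1.
  have nC : 0 < (n.+1%:R^-1 : R)%:C by rewrite ltcR invr_gt0.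
  have [_ [[x Vx <-]]] := ycl _ (nbhsx_ballx y _ nC).
  by rewrite -ball_normE/= -rnormE ltcR; exists x.
have [u uP] := choice near_y.
have Tu : (fun n => T (u n)) @ \oo --> y.
  apply/cvg_rnormP.
  apply: (squeeze_cvgr _ (cvg_cst 0) (@cvg_harmonic R)); apply: nearW => n.
  by rewrite rnorm_ge0/= rnormB ltW//; case: (uP n).
have [x ux] : exists x, u @ \oo --> x.
  apply/cvg_ex; apply: cauchy_rnorm_cvgn => d d0.
  have /cvg_rnormP/cvgrPdist_lt/(_ (e * d / 2)) := Tu.
  case=> [|N _ NP]; first by rewrite divr_gt0// mulr_gt0.
  exists N => m n Nm mn.
  have := NP _ Nm; have := NP _ (leq_trans Nm mn).
  rewrite /= !sub0r !normrN !ger0_norm ?rnorm_ge0// => Tn Tm.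
  have Vmn : V (u n - u m) by case: (uP n) => Vn _; case: (uP m) => Vm _; exact: subspaceB.
  have := eT _ Vmn; rewrite linearB/=.
  have -> : T (u n) - T (u m) = (T (u n) - y) + (y - T (u m)) by rewrite addrA subrK.
  have := ler_rnormD (T (u n) - y) (y - T (u m)); rewrite [rnorm (y - _)]rnormB => a b.
  have : e * rnorm (u n - u m) < e * d by lra.
  by rewrite ltr_pM2l.
exists x; last exact: cvgn_uniq (cvgn_linear Tc ux) Tu.
by apply: (closed_cvg _ Vc _ _ ux); apply: nearW => n; case: (uP n).
Qed.

Lemma orthogonal_part_closed L : closed (orthogonal_part [set: H] L).
Proof.
rewrite (_ : orthogonal_part _ L = orthocomplement ip [set y | y \in L]).
  exact: orthocomplement_closed.
by apply/seteqP; split=> x => [[_]|].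
Qed.

(** The component of [y] orthogonal to the range is killed by the symmetric
    operator [T]. *)
Lemma closed_range_complement T y : continuous T -> self_adjoint ip T ->
  closed (range T) -> exists x, T (y - T x) = 0.
Proof.
move=> Tc Tsa Tcl.
have [_ [x _ <-] yx] := projection ip_norm y (range_subspace T setT_subspace) Tcl.
exists x; apply/eqP; rewrite -(dnorm_eq0 ip) Tsa; apply/eqP; apply: yx.
by exists (T (y - T x)).
Qed.

(** The part of the kernel orthogonal to [L] is zero and the image of the
    orthogonal complement of [L] is closed, so the kernel is
    finite-dimensional and the range closed; the kernel then complements the
    range. *)
Lemma bounded_below_fredholm T L (e : R) : continuous T -> self_adjoint ip T ->
  0 < e ->
  (forall x, (forall y, y \in L -> ip x y = 0) -> e * rnorm x <= rnorm (T x)) ->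
  fredholm T.
Proof.
move=> Tc Tsa e0 eT.
have kerT : finite_dim [set x | T x = 0].
  apply: (@finite_codim_ind _ (fun W v _ => @finite_dim_add_line W v) L).
    split=> [|a x y /= Tx Ty]; first exact: linear0.
    by rewrite linearP Tx Ty scaler0 addr0.
  rewrite (_ : orthogonal_part _ L = [set 0]); first exact: finite_dim0.
  apply/seteqP; split=> [x [/= Tx xL]|_ ->]; last first.
    by split=> [|y _]; [exact: linear0|exact: linear0l].
  have := eT _ xL; rewrite Tx rnorm0 pmulr_rle0// => x0.
  by apply/eqP; rewrite -rnorm_eq0 eq_le x0 rnorm_ge0.
have Tcl : closed (range T).
  apply: (@finite_codim_ind (fun W => closed (T @` W)) _ L _ setT_subspace).
    move=> W v Ws; rewrite image_add_line; apply: closed_add_line.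
    exact: range_subspace.
  apply: (bounded_below_closed_range Tc e0).
  - exact: orthogonal_part_subspace setT_subspace.
  - exact: orthogonal_part_closed.
  - by move=> x [_]; exact: eT.
split=> //; have [n [v vE]] := kerT; exists n, v => y.
have [x Tx] := closed_range_complement y Tc Tsa Tcl.
by exists (T x); [exists x|rewrite -vE].
Qed.

(** One step of a Weyl singular sequence: if there were no such [g], the
    operator would be bounded below on the orthogonal complement of [L]. *)
Lemma singular_vector T L (e : R) : continuous T -> self_adjoint ip T ->
  ~ fredholm T -> 0 < e ->
  exists g, [/\ rnorm g = 1, (forall y, y \in L -> ip g y = 0) & rnorm (T g) < e].
Proof.
move=> Tc Tsa nF e0; apply: contrapT => ng; apply: nF.
apply: (bounded_below_fredholm (L := L) Tc Tsa e0) => x xL.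
rewrite leNgt; apply/negP => /small_unit_vector[x1 Tx]; apply: ng.
exists ((rnorm x)^-1%:C *: x); split=> // y yL.
by rewrite ipZl xL// mulr0.
Qed.

Lemma orthogonal_unit_vector L : infinite_dimensional H ->
  exists g, rnorm g = 1 /\ forall y, y \in L -> ip g y = 0.
Proof.
move=> Hinf; have [[x [xL x0]]|nx] :=
    pselect (exists x, orthogonal_part [set: H] L x /\ x != 0).
  exists ((rnorm x)^-1%:C *: x); split; first exact: rnorm_normalize.
  by move=> y yL; case: xL => _ xL; rewrite linearZl_LR/= xL// mulr0.
case: Hinf; apply: (@finite_codim_ind _ (fun W v _ => @finite_dim_add_line W v) L).
  exact: setT_subspace.
rewrite (_ : orthogonal_part _ L = [set 0]); first exact: finite_dim0.
apply/seteqP; split=> [x xL /=|_ ->]; last by split=> // y _; exact: linear0l.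
by apply/eqP/negPn/negP => x0; apply: nx; exists x.
Qed.

Lemma scalar_minus_operator (A : {linear H -> H}) (l : R) :
  continuous A -> self_adjoint ip A ->
  exists T : {linear H -> H}, [/\ T = scalar_minus l%:C A :> (H -> H),
    continuous T & self_adjoint ip T].
Proof.
move=> Ac Asa.
have lin : linear (scalar_minus l%:C A).
  move=> a x y; rewrite /scalar_minus (linearP A) scalerDr opprD addrACA scalerBr.
  by rewrite !scalerA (mulrC a).
pose T : {linear H -> H} :=
  HB.pack (scalar_minus l%:C A) (GRing.isLinear.Build _ _ _ _ _ lin).
exists T; split=> //=.
  move=> x; apply: cvgB; last exact: Ac.
  by apply: cvgZl_tmp; exact: cvg_id.
move=> x y; rewrite /= /scalar_minus linearBl linearBr/= linearZl_LR linearZr_LR/=.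
by rewrite Asa; congr (_ * _ - _); rewrite /Num.conj/= oppr0.
Qed.

End Fredholm.

(** * Chains of orthogonal planes *)

Section Sites.

(** The sites of a bilateral chain, [... 5 -> 3 -> 1 -> 0 -> 2 -> 4 ...],
    numbered in an order in which they can be built one after the other. *)
Definition next_site s := if odd s then if s is s'.+2 then s' else 0%N else s.+2.
Definition prev_site s := if odd s then s.+2 else if s is s'.+2 then s' else 1%N.

Lemma next_siteK : cancel next_site prev_site.
Proof.
case=> [|[|s]]//; rewrite /next_site/= negbK; case: ifP => os.
  by rewrite /prev_site os.
by rewrite /prev_site/= !negbK os.
Qed.

Lemma prev_siteK : cancel prev_site next_site.
Proof.
case=> [|[|s]]//; rewrite /prev_site/= negbK; case: ifP => os.
  by rewrite /next_site/= !negbK os.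
by rewrite /next_site os.
Qed.

Lemma next_site_even n : next_site n.*2 = n.+1.*2.
Proof. by rewrite /next_site odd_double. Qed.

Lemma next_site_odd n : next_site n.+1.*2.+1 = n.*2.+1.
Proof. by rewrite /next_site/= odd_double. Qed.

(** Solve forwards with [f] along the even sites and backwards with [f'] along
    the odd sites, starting from [x0] at site 0. *)
Lemma chain_orbit (X : Type) (P : X -> Prop) (f f' : nat -> X -> X) (x0 : X) :
  (forall s x, P x -> P (f s x)) -> (forall s x, P x -> P (f' s x)) ->
  (forall s x, P x -> f s (f' s x) = x) -> P x0 ->
  exists x, forall s, P (x s) /\ x (next_site s) = f s (x s).
Proof.
move=> fP f'P f'K Px0.
pose ev := fix ev n := if n is n'.+1 then f n'.*2 (ev n') else x0.
pose od := fix od n := if n is n'.+1 then f' n.*2.+1 (od n') else f' 1%N x0.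
have evP n : P (ev n) by elim: n => //= n; exact: fP.
have odP n : P (od n) by elim: n => [|n IH] /=; exact: f'P.
pose x s := if odd s then od s./2 else ev s./2.
have xE n : x n.*2 = ev n by rewrite /x odd_double doubleK.
have xO n : x n.*2.+1 = od n by rewrite /x/= odd_double/= uphalf_double.
exists x => s; have [n [->|->]] : exists n, s = n.*2 \/ s = n.*2.+1.
    exists s./2; rewrite -{1 3}(odd_double_half s).
    by case: (odd s); [right|left].
  by rewrite next_site_even !xE.
case: n => [|n].
  split; first by rewrite (xO 0%N); exact: odP.
  by rewrite (xO 0%N) f'K//; exact: (xE 0%N).
by rewrite next_site_odd !xO; split; [exact: odP|rewrite /= f'K].
Qed.

End Sites.

Section Quaternions.
Context {C : numClosedFieldType} {V : lmodType C}.
Implicit Types x y : C * C.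

(** Rotating an orthonormal pair [g, g'] by the unit quaternion [(a, b)] gives
    the pair with respect to which [g] has coordinates [(a, b)]. *)
Definition rot0 (a b : C) (g g' : V) : V := a^* *: g - b *: g'.
Definition rot1 (a b : C) (g g' : V) : V := b^* *: g + a *: g'.

(** [(a, b)] stands for the quaternion [a + b j]. *)
Definition qmul (x y : C * C) : C * C :=
  (x.1 * y.1 - x.2 * y.2^*, x.1 * y.2 + x.2 * y.1^*).
Definition qinv (x : C * C) : C * C := (x.1^*, - x.2).
Definition qunit (x : C * C) := x.1 * x.1^* + x.2 * x.2^* = 1.

Lemma qmul_unit x y : qunit x -> qunit y -> qunit (qmul x y).
Proof.
rewrite /qunit /qmul/= => x1 y1; rewrite -[RHS]mulr1 -{1}x1 -y1.
by rewrite rmorphB rmorphD !rmorphM/= !conjCK; ring.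
Qed.

Lemma qinv_unit x : qunit x -> qunit (qinv x).
Proof. by rewrite /qunit /qinv/= conjCK rmorphN mulrNN mulrC. Qed.

Lemma qmulVK x y : qunit x -> qmul x (qmul (qinv x) y) = y.
Proof.
case: x y => [p q] [a b]; rewrite /qunit /qmul /qinv/= => pq.
rewrite !(rmorphD, rmorphN, rmorphM)/= !conjCK.
congr pair; rewrite -[RHS]mul1r -pq; ring.
Qed.

Lemma rot_coord x y (g g' : V) : qunit y ->
  x.1 *: g + x.2 *: g' = (qmul x y).1 *: rot0 y.1 y.2 g g' +
                         (qmul x y).2 *: rot1 y.1 y.2 g g'.
Proof.
case: x y => [p q] [a b]; rewrite /qunit /qmul /rot0 /rot1/= => ab.
rewrite scalerBr scalerDr !scalerA addrACA -scalerDl -scaleNr -scalerDl.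
congr (_ *: _ + _ *: _); [rewrite -[LHS]mulr1 -ab; ring|].
by rewrite -[LHS]mulr1 -ab; ring.
Qed.

End Quaternions.

Section Blocks.
Context {R : realType} {H : completeNormedModType R[i]}.
Variable ip : {dot H for Num.conj}.
Hypothesis ip_norm : norm_induced_by ip.
Hypothesis H_inf : infinite_dimensional H.
Variable A : {linear H -> H}.
Hypotheses (A_cont : continuous A) (A_sa : self_adjoint ip A).

Definition interleave (g g' : nat -> H) k := if odd k then g' k./2 else g k./2.

Lemma interleave_orthonormal (g g' : nat -> H) :
  orthonormal_seq ip g -> orthonormal_seq ip g' ->
  (forall m n, ip (g m) (g' n) = 0) -> orthonormal_seq ip (interleave g g').
Proof.
move=> go g'o gg' m n; rewrite /interleave eqn_odd_half.
case: ifPn => om; case: ifPn => on; rewrite ?go ?g'o ?gg'//=.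
exact: ip_eq0C.
Qed.

(** The approximate eigenvector [h.1] is chosen orthogonal to [L] and to [A L];
    since [A] is symmetric, [A h.1] is then orthogonal to [L] too. If [h.1]
    happens to be an exact eigenvector, any further vector serves as [h.2]. *)
Lemma next_block (L : seq H) (l e : R) :
  ~ fredholm (scalar_minus l%:C A) -> 0 < e ->
  exists h : H * H, [/\ rnorm h.1 = 1, rnorm h.2 = 1, ip h.1 h.2 = 0,
    (forall y, y \in L -> ip h.1 y = 0 /\ ip h.2 y = 0) &
    (exists c : R[i] * R[i], A h.1 = c.1 *: h.1 + c.2 *: h.2) /\
    rnorm (l%:C *: h.1 - A h.1) < e].
Proof.
have [T [TE Tc Tsa]] := scalar_minus_operator l A_cont A_sa.
rewrite -TE => nF e0.
have [g [g1 gL gT]] := singular_vector ip_norm (L ++ map A L) Tc Tsa nF e0.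
have {}gT : rnorm (l%:C *: g - A g) < e by move: gT; rewrite TE.
have {gL}[gL gAL] : (forall y, y \in L -> ip g y = 0) /\
    (forall y, y \in L -> ip (A g) y = 0).
  split=> y yL; first by apply: gL; rewrite mem_cat yL.
  by rewrite A_sa; apply: gL; rewrite mem_cat map_f ?orbT.
pose w := A g - ip (A g) g *: g.
have wg : ip w g = 0.
  by rewrite /w linearBl/= linearZl_LR/= (rnorm_unit ip_norm g1) mulr1 subrr.
have wL y : y \in L -> ip w y = 0.
  by move=> yL; rewrite linearBl/= linearZl_LR/= gAL// gL// mulr0 subr0.
have [w0|w0] := eqVneq w 0.
  have [g' [g'1 g'L]] := orthogonal_unit_vector ip (g :: L) H_inf.
  exists (g, g'); split=> //=.
  - by apply: ip_eq0C; apply: g'L; rewrite mem_head.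
  - by move=> y yL; split; [exact: gL|apply: g'L; rewrite in_cons yL orbT].
  - split=> //; exists (ip (A g) g, 0); rewrite scale0r addr0.
    by apply/eqP; rewrite -subr_eq0 -/w w0.
exists (g, (rnorm w)^-1%:C *: w); split=> //=.
- exact: rnorm_normalize.
- by rewrite linearZr_LR/= (ip_eq0C wg) mulr0.
- move=> y yL; split; first exact: gL.
  by rewrite linearZl_LR/= wL// mulr0.
- split=> //; exists (ip (A g) g, (rnorm w)%:C); rewrite /= scalerA -rmorphM/=.
  by rewrite divff ?rnorm_eq0// scale1r /w addrC subrK.
Qed.

(** The state [st n] of the recursion lists the vectors of the first [n]
    blocks. *)
Lemma block_sequence (l e : nat -> R) :
  (forall s, ~ fredholm (scalar_minus (l s)%:C A)) -> (forall s, 0 < e s) ->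
  exists g g' : nat -> H, [/\ orthonormal_seq ip g, orthonormal_seq ip g',
    (forall m n, ip (g m) (g' n) = 0),
    (forall s, exists c : R[i] * R[i], A (g s) = c.1 *: g s + c.2 *: g' s) &
    (forall s, rnorm ((l s)%:C *: g s - A (g s)) < e s)].
Proof.
move=> nF e0.
have step (Ls : seq H * nat) := next_block Ls.1 (nF Ls.2) (e0 Ls.2).
have [F FP] := choice step.
pose st := fix st n := if n is n'.+1 then
  let h := F (st n', n') in [:: h.1, h.2 & st n'] else [::].
pose h n := F (st n, n).
have hst m n : (m < n)%N -> (h m).1 \in st n /\ (h m).2 \in st n.
  elim: n => // n IH; rewrite ltnS leq_eqVlt => /orP[/eqP ->|/IH[h1 h2]] /=.
    by rewrite !in_cons !eqxx orbT.
  by rewrite !in_cons h1 h2 !orbT.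
have hlt m n : (m < n)%N -> [/\ ip (h n).1 (h m).1 = 0, ip (h n).1 (h m).2 = 0,
    ip (h n).2 (h m).1 = 0 & ip (h n).2 (h m).2 = 0].
  move=> /hst[h1 h2]; have [_ _ _ hL _] := FP (st n, n).
  by have [? ?] := hL _ h1; have [? ?] := hL _ h2.
exists (fun n => (h n).1), (fun n => (h n).2); split.
- move=> m n; case: (ltngtP m n) => [/hlt[/ip_eq0C]//|/hlt[]//|<-].
  by have [h1 _ _ _ _] := FP (st m, m); rewrite (rnorm_unit ip_norm h1).
- move=> m n; case: (ltngtP m n) => [/hlt[_ _ _ /ip_eq0C]//|/hlt[]//|<-].
  by have [_ h1 _ _ _] := FP (st m, m); rewrite (rnorm_unit ip_norm h1).
- move=> m n; case: (ltngtP m n) => [/hlt[_ _ /ip_eq0C]//|/hlt[]//|<-].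
  by have [_ _ h1 _ _] := FP (st m, m).
- by move=> s; have [_ _ _ _ []] := FP (st s, s).
- by move=> s; have [_ _ _ _ []] := FP (st s, s).
Qed.

Lemma rot_orthonormal (c : nat -> R[i] * R[i]) (g g' : nat -> H) :
  orthonormal_seq ip g -> orthonormal_seq ip g' ->
  (forall m n, ip (g m) (g' n) = 0) -> (forall s, qunit (c s)) ->
  [/\ orthonormal_seq ip (fun s => rot0 (c s).1 (c s).2 (g s) (g' s)),
      orthonormal_seq ip (fun s => rot1 (c s).1 (c s).2 (g s) (g' s)) &
      forall m n, ip (rot0 (c m).1 (c m).2 (g m) (g' m))
                     (rot1 (c n).1 (c n).2 (g n) (g' n)) = 0].
Proof.
move=> go g'o gg' cu; have g'g m n : ip (g' m) (g n) = 0 by exact: ip_eq0C.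
have ipE (a b a' b' : R[i]) m n : ip (a *: g m + b *: g' m) (a' *: g n + b' *: g' n) =
    (m == n)%:R * (a * a'^* + b * b'^*).
  rewrite ipDl !ipDr !ipZl !ipZr go g'o gg' g'g.
  by rewrite !mulr0 addr0 add0r mulrDr !mulrA; congr (_ + _); ring.
rewrite /rot0 /rot1; split=> m n; rewrite -?scaleNr ipE; case: eqP => [<-|_];
  rewrite ?mul0r// mul1r ?rmorphN ?conjCK.
- by rewrite mulrNN mulrC; exact: cu.
- by rewrite mulrC addrC; exact: cu.
- by ring.
Qed.

(** The isometry [A g_s / w_s |-> g_(next s)] respects the chain of orthogonal
    planes spanned by [g_s] and [g'_s].  Rotated bases of the planes in which
    it only permutes basis vectors are found by solving along the chain:
    the coordinates of [g_(next s)] have to be those of [A g_s / w_s]. *)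
Lemma block_shift f (g g' : nat -> H) (w : nat -> R) :
  is_onb ip f -> orthonormal_seq ip g -> orthonormal_seq ip g' ->
  (forall m n, ip (g m) (g' n) = 0) ->
  (forall s, exists c : R[i] * R[i], A (g s) = c.1 *: g s + c.2 *: g' s) ->
  (forall s, w s = rnorm (A (g s))) -> (forall s, w s != 0) ->
  exists2 U : {linear H -> H}, unitary_spread ip U &
    forall s, U (A (g s)) = (w s)%:C *: g (next_site s).
Proof.
move=> fb go g'o gg' Ag wE w0.
have [c cP] := choice Ag.
pose x s : R[i] * R[i] := ((w s)%:C^-1 * (c s).1, (w s)%:C^-1 * (c s).2).
have wC s : (w s)%:C != 0 :> R[i] by rewrite (inj_eq (@complexI R) _ 0).
have xE s : (w s)%:C *: ((x s).1 *: g s + (x s).2 *: g' s) = A (g s).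
  by rewrite scalerDr !scalerA /x/= !mulrA divff// !mul1r cP.
have xu s : qunit (x s).
  have := ip_self ip_norm (A (g s)); rewrite -wE -{1 2}xE.
  rewrite ipZl ipZr ipDl !ipDr !ipZl !ipZr.
  rewrite go g'o gg' (ip_eq0C (gg' _ _)) !eqxx !mulr1 !mulr0 addr0 add0r.
  have -> : ((w s)%:C : R[i])^* = (w s)%:C.
    by apply: CrealP; apply/complex_realP; exists (w s).
  rewrite rmorphXn/= expr2 mulrA => xw.
  by apply: (mulfI (mulf_neq0 (wC s) (wC s))); rewrite mulr1.
clearbody x.
have [y yP] := @chain_orbit _ qunit (fun s => qmul (x s)) (fun s => qmul (qinv (x s))) (1, 0)
  (fun s z => @qmul_unit _ _ z (xu s)) (fun s z => @qmul_unit _ _ z (qinv_unit (xu s)))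
  (fun s z _ => qmulVK z (xu s))
  ltac:(by rewrite /qunit/= rmorph1 mulr1 mul0r addr0).
have yu s : qunit (y s) by case: (yP s).
have [e0o e1o e01] := rot_orthonormal go g'o gg' yu.
set e0 := (fun s => rot0 _ _ _ _) in e0o e01; set e1 := (fun s => rot1 _ _ _ _) in e1o e01.
pose t (h : nat -> nat) k := ((h k./2).*2 + odd k)%N.
have tK h h' : cancel h h' -> cancel (t h) (t h').
  move=> hK k; have -> : t h k = (odd k + (h k./2).*2)%N by rewrite /t addnC.
  by rewrite /t half_bit_double hK oddD odd_double addbF oddb addnC odd_double_half.
have [U Us Ue] := orthonormal_permutation_spread ip_norm fb
  (interleave_orthonormal e0o e1o e01) (tK _ _ next_siteK) (tK _ _ prev_siteK).
have U0 s : U (e0 s) = e0 (next_site s).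
  have := Ue s.*2; rewrite /t /interleave odd_double doubleK addn0.
  by rewrite odd_double doubleK.
have U1 s : U (e1 s) = e1 (next_site s).
  have := Ue s.*2.+1; rewrite /t /interleave/= odd_double/= uphalf_double addn1.
  by rewrite /= odd_double/= uphalf_double.
exists U => // s; rewrite -xE linearZ/=; congr (_ *: _).
have [_ /= ys] := yP s.
rewrite (rot_coord _ _ _ (yu s)) -ys linearD !linearZ/= -/(e0 s) -/(e1 s) U0 U1.
have := rot_coord (1, 0) (g (next_site s)) (g' (next_site s)) (yu (next_site s)).
rewrite /qmul/= scale1r scale0r addr0 !mul1r !mul0r subr0 addr0.
by move=> ->.
Qed.

End Blocks.

(** * Isolated eigenvalues *)

Section Hellinger.
Context {R : realType} {H : completeNormedModType R[i]}.
Variable ip : {dot H for Num.conj}.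
Hypothesis ip_norm : norm_induced_by ip.
Implicit Types (x y : H) (T A : {linear H -> H}).

Lemma larger_shift (z t : R[i]) : rnorm t <= rnorm (z + t) \/ rnorm t <= rnorm (z - t).
Proof.
have [h|h] := leP (rnorm t) (rnorm (z + t)); [by left|right].
have := ler_rnormD (z + t) (t - z).
have -> : z + t + (t - z) = 2 * t by ring.
rewrite rnormM [rnorm (t - z)]rnormB.
have -> : rnorm (2 : R[i]) = 2.
  by rewrite -(rmorph_nat (real_complex R) 2) rnorm_real ger0_norm.
by lra.
Qed.

(** A gliding hump: if unit vectors [x m] had [T (x m)] of size below
    [3 ^- m / (m + 1)], signs could be chosen so that the sum [y] of the series
    of the [+- 3 ^- m x m] has an inner product at least [3 ^- m / 2] with every
    [x m]; but for [y = T z] this product is at most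
    [|z| * 3 ^- m / (m + 1)]. *)
Lemma symmetric_onto_bounded_below T : self_adjoint ip T ->
  (forall y, exists x, T x = y) ->
  exists2 c : R, 0 < c & forall x, c * rnorm x <= rnorm (T x).
Proof.
move=> Tsa Tonto; apply: contrapT => nc.
have small (e : R) : 0 < e -> exists x, rnorm x = 1 /\ rnorm (T x) < e.
  move=> e0; apply: contrapT => nx; apply: nc; exists e => // x.
  rewrite leNgt; apply/negP => /small_unit_vector; apply: contra_not nx => Tx.
  by exists ((rnorm x)^-1%:C *: x).
pose r : R := 3^-1; have r0 : 0 < r by rewrite invr_gt0.
have rX n : 0 < r ^+ n by rewrite exprn_gt0.
have [x xP] := choice (fun n : nat => small _ (divr_gt0 (rX n) (ltr0Sn R n))).
pose step m y := if `[< rnorm ((r ^+ m)%:C) <= rnorm (ip y (x m) + (r ^+ m)%:C) >]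
  then y + (r ^+ m)%:C *: x m else y - (r ^+ m)%:C *: x m.
pose s := fix s m := if m is m'.+1 then step m' (s m') else 0.
have rXC m : rnorm (r ^+ m)%:C = r ^+ m by rewrite rnorm_real gtr0_norm.
have sS m : rnorm (s m.+1 - s m) = r ^+ m.
  have [x1 _] := xP m; rewrite /= /step; case: ifP => _.
    by rewrite addrAC subrr add0r rnormZ rXC x1 mulr1.
  by rewrite addrAC subrr add0r rnormN rnormZ rXC x1 mulr1.
have s_hump m : r ^+ m <= rnorm (ip (s m.+1) (x m)).
  have [x1 _] := xP m; have xx := rnorm_unit ip_norm x1.
  rewrite /= /step; case: asboolP => h.
    by rewrite ipDl ipZl xx mulr1 -{1}rXC.
  have [//|] := larger_shift (ip (s m) (x m)) (r ^+ m)%:C.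
  by rewrite linearBl/= ipZl xx mulr1 rXC.
(* [3 / 2 * r ^+ m] is the sum of the geometric series from [m] on. *)
have s_dist m n : (m <= n)%N -> rnorm (s n - s m) <= 3 / 2 * (r ^+ m - r ^+ n).
  elim: n => [|n IH]; first by rewrite leqn0 => /eqP ->; rewrite !subrr rnorm0 mulr0.
  rewrite leq_eqVlt => /orP[/eqP ->|]; first by rewrite !subrr rnorm0 mulr0.
  rewrite ltnS => /IH mn; have := ler_rnormD (s n.+1 - s n) (s n - s m).
  rewrite addrA subrK sS => /le_trans; apply.
  rewrite exprS /r; move: mn; rewrite -/r; move: (r ^+ n) (r ^+ m) => a b.
  by rewrite /r; lra.
have s_dist' m n : (m <= n)%N -> rnorm (s n - s m) <= 3 / 2 * r ^+ m.
  by move=> /s_dist; have := rX n; lra.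
have [y sy] : exists y, s @ \oo --> y.
  apply/cvg_ex; apply: cauchy_rnorm_cvgn => e e0.
  have /cvgrPdist_lt/(_ (e / 2)) : (fun n => r ^+ n) @ \oo --> (0 : R).
    by apply: cvg_expr; rewrite gtr0_norm// /r; lra.
  case=> [|N _ NP]; first by rewrite divr_gt0.
  exists N => m n Nm mn; have := s_dist' _ _ mn; have := NP _ Nm.
  by rewrite /= sub0r normrN gtr0_norm//; lra.
have ys m : rnorm (y - s m) <= 3 / 2 * r ^+ m.
  have sm : (fun n => s (n + m)%N - s m) @ \oo --> y - s m.
    by apply: cvgB; [have := sy; rewrite -(cvg_shiftn m); exact|exact: cvg_cst].
  by apply: (rnorm_lim_le sm) => n; apply: s_dist'; rewrite leq_addl.
have y_hump m : r ^+ m / 2 <= rnorm (ip y (x m)).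
  have [x1 _] := xP m.
  have := s_hump m; have := cauchy_schwarz ip_norm (y - s m.+1) (x m).
  have := ys m.+1; rewrite x1 mulr1 linearBl/=.
  have := ler_rnormB (ip (s m.+1) (x m)) (ip y (x m)).
  move/le_trans => h1 h2 h3 h4.
  have := ler_rnormD (ip y (x m)) (ip (s m.+1) (x m) - ip y (x m)).
  rewrite addrCA subrr addr0 [rnorm (_ - ip y _)]rnormB.
  move: h2; rewrite exprS {1}/r; move: h3 h4 (rX m); move: (r ^+ m) => a.
  by lra.
have [z Tz] := Tonto y.
have [m mz] : exists m : nat, 2 * rnorm z < m.+1%:R.
  by exists (Num.truncn (2 * rnorm z)); exact: truncnS_gt.
have [_ xm] := xP m; have := y_hump m; rewrite -Tz Tsa => h.
have := le_trans h (cauchy_schwarz ip_norm z (T (x m))); apply/negP; rewrite -ltNge.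
have m1 : 0 < m.+1%:R :> R by [].
have [z0|z0] := eqVneq (rnorm z) 0; first by rewrite z0 mul0r divr_gt0.
have zp : 0 < rnorm z by rewrite lt0r z0 rnorm_ge0.
apply: lt_trans (_ : rnorm z * (r ^+ m / m.+1%:R) < _); first by rewrite ltr_pM2l.
rewrite mulrCA ltr_pM2l// ltr_pdivrMr// ltr_pdivlMl//.
Qed.

(** Otherwise [t - A] would be injective with closed range, hence onto because
    it is symmetric, hence bounded below, and its inverse would be
    continuous. *)
Lemma isolated_eigenvalue A (t : R) : continuous A -> self_adjoint ip A ->
  spectrum A t%:C -> ~ essential_spectrum A t%:C ->
  exists x, rnorm x = 1 /\ A x = t%:C *: x.
Proof.
move=> Ac Asa; rewrite /spectrum /essential_spectrum/=.
have [T [TE Tc Tsa]] := scalar_minus_operator t Ac Asa; rewrite -TE.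
move=> ninv /contrapT[_ Tcl _]; apply: contrapT => nx; apply: ninv.
have Tker x : T x = 0 -> x = 0.
  move=> Tx; apply/eqP/negPn/negP => x0; apply: nx.
  exists ((rnorm x)^-1%:C *: x); split; first exact: rnorm_normalize.
  rewrite linearZ/= scalerA mulrC -scalerA; congr (_ *: _); apply/eqP.
  by rewrite eq_sym -subr_eq0 -/(scalar_minus _ _ _) -TE Tx.
have Tonto y : exists x, T x = y.
  have [x /Tker/eqP] := closed_range_complement ip_norm y Tc Tsa Tcl.
  by rewrite subr_eq0 => /eqP ->; exists x.
have [c c0 cT] := symmetric_onto_bounded_below Tsa Tonto.
have [S TS] := choice Tonto.
have ST : cancel T S.
  by move=> x; apply/eqP; rewrite -subr_eq0; apply/eqP/Tker; rewrite linearB/= TS subrr.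
have Slin : linear S.
  by move=> a x y; apply: (can_inj ST); rewrite linearP !TS.
pose Sl : {linear H -> H} := HB.pack S (GRing.isLinear.Build _ _ _ _ S Slin).
exists Sl; split=> //.
apply: (@rnorm_lipschitz_continuous _ _ _ _ c^-1) => y.
by rewrite -{2}[y]TS ler_pdivlMl.
Qed.

Lemma eigenvectors_orthogonal A (a b : R) x y : self_adjoint ip A ->
  A x = a%:C *: x -> A y = b%:C *: y -> a != b -> ip x y = 0.
Proof.
move=> Asa Ax Ay ab; have := Asa x y; rewrite Ax Ay ipZl ipZr.
have -> : (b%:C : R[i])^* = b%:C by apply: CrealP; apply/complex_realP; exists b.
move/eqP; rewrite -subr_eq0 -mulrBl mulf_eq0 => /orP[|/eqP//].
by rewrite subr_eq0 (inj_eq (@complexI R)) (negPf ab).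
Qed.

Lemma eigenvector_sequence A (t : nat -> R) : continuous A -> self_adjoint ip A ->
  injective t -> (forall k, spectrum A (t k)%:C) ->
  (forall k, ~ essential_spectrum A (t k)%:C) ->
  exists x : nat -> H, orthonormal_seq ip x /\ forall k, A (x k) = (t k)%:C *: x k.
Proof.
move=> Ac Asa t_inj tA tE.
have [x xP] := choice (fun k => isolated_eigenvalue Ac Asa (tA k) (tE k)).
exists x; split=> [m n|k]; last by case: (xP k).
have [x1 Axm] := xP m; have [_ Axn] := xP n.
have [<-|mn] := eqVneq m n; first exact: rnorm_unit.
by apply: (eigenvectors_orthogonal Asa Axm Axn); rewrite (inj_eq t_inj).
Qed.

End Hellinger.

(** * Schauder spectra containing annuli and circles *)

Section Main.
Context {R : realType} {H : completeNormedModType R[i]}.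
Variable ip : {dot H for Num.conj}.
Hypothesis ip_norm : norm_induced_by ip.

(** Such a [U] turns [A] into a bilateral weighted shift on the span of [g];
    each [z] of modulus [rho] is one of its eigenvalues. *)
Lemma chain_schauder_spectrum (A U : {linear H -> H}) (g : nat -> H) (w : nat -> R)
    (rho : R) : continuous A -> unitary_spread ip U -> orthonormal_seq ip g ->
  (forall s, U (A (g s)) = (w s)%:C *: g (next_site s)) ->
  (forall n, w n.*2.+1 != 0) -> 0 < rho ->
  cvgn (series (fun n => \prod_(k < n.+1) (w k.*2 / rho) ^+ 2)) ->
  cvgn (series (fun n => \prod_(k < n.+1) (rho / w k.*2.+1) ^+ 2)) ->
  [set z : R[i] | `|z| = rho%:C] `<=` schauder_spectrum ip (U \o A).
Proof.
move=> Ac [Uc _ _] go UA w0 rho0 cvg_even cvg_odd z /=; rewrite -rnormE => /complexI zrho.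
have UAc : continuous (U \o A).
  by move=> x; apply: continuous_comp; [exact: Ac|exact: Uc].
have [|||n|||x x0 Ux] := @bilateral_shift_eigenvector R H ip ip_norm (U \o A)
  (fun n => g n.*2) (fun n => g n.*2.+1) (fun n => w n.*2) (fun n => w n.*2.+1)
  z rho UAc _ _ _ _ _ _ rho0 zrho w0 cvg_even cvg_odd.
- by move=> m n; rewrite go -!muln2 eqn_pmul2r.
- by move=> m n; rewrite go eqSS -!muln2 eqn_pmul2r.
- move=> m n; rewrite go; case: eqP => // mn.
  by have := congr1 odd mn; rewrite /= !odd_double.
- by rewrite /= UA next_site_even.
- by rewrite /= UA.
- by move=> n; rewrite /= UA next_site_odd.
exact: (eigenvalue_schauder_spectrum ip_norm UAc x0 Ux).
Qed.

(** If consecutive ratios stay below [q < 1] then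
    [sum_(k < n) P k + P n / (1 - q)] is nonincreasing, which bounds the partial
    sums. *)
Lemma prod_ratio_cvgn (y : nat -> R) (l : R) : (forall k, 0 <= y k) ->
  y @ \oo --> l -> l < 1 -> cvgn (series (fun n => \prod_(k < n.+1) y k)).
Proof.
move=> y0 yl l1; pose P n := \prod_(k < n.+1) y k.
have P0 n : 0 <= P n by apply: prodr_ge0.
have PS n : P n.+1 = P n * y n.+1 by rewrite /P big_ord_recr.
pose q := (l + 1) / 2; have q1 : 0 < 1 - q by rewrite /q; lra.
have [N _ NP] : \forall n \near \oo, y n <= q.
  have /cvgrPdist_lt/(_ _ q1) := yl; apply: filterS => n.
  by rewrite ltr_norml /q => /andP[h _]; lra.
have SN n : (N <= n)%N ->
    series P n + P n / (1 - q) <= series P N + P N / (1 - q).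
  elim: n => [|n IH]; first by rewrite leqn0 => /eqP ->.
  rewrite leq_eqVlt => /orP[/eqP ->//|]; rewrite ltnS => Nn.
  apply: le_trans (IH Nn); rewrite seriesSr PS -addrA lerD2l.
  have yq : y n.+1 <= q by apply: NP; rewrite /= (leq_trans Nn).
  rewrite -[X in X + _ <= _](@mulfK _ (1 - q)) ?gt_eqF// -mulrDl.
  rewrite ler_pM2r ?invr_gt0// -mulrDr ler_piMr ?P0//.
  by lra.
have S_nd : nondecreasing_seq (series P).
  by apply: nondecreasing_series => n _ _; exact: P0.
apply: nondecreasing_is_cvgn => //.
exists (series P N + P N / (1 - q)) => _ [n _ <-].
have [nN|/ltnW Nn] := leqP n N.
  apply: le_trans (_ : series P N <= _); first exact: S_nd.
  by rewrite lerDl divr_ge0// ltW.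
by apply: le_trans (SN _ Nn); rewrite lerDl divr_ge0// ltW.
Qed.

Variable A : {linear H -> H}.
Hypotheses (A_cont : continuous A) (A_sa : self_adjoint ip A).
Variable f : nat -> H.
Hypothesis f_onb : is_onb ip f.

(** Blocks on which [A] is nearly [l1] occupy the even sites, the forward half
    of the chain, and blocks on which [A] is nearly [l2] the odd sites. The
    coefficients of an eigenvector are multiplied by about [l1 / rnorm z] per
    step forwards and by about [rnorm z / l2] per step backwards. *)
Lemma annulus_schauder_spectrum (l1 l2 : R) : infinite_dimensional H ->
  0 < l1 -> l1 < l2 ->
  essential_spectrum A l1%:C -> essential_spectrum A l2%:C ->
  exists2 U : {linear H -> H}, unitary_spread ip U &
    open_annulus l1 l2 `<=` schauder_spectrum ip (U \o A).
Proof.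
move=> H_inf l1p l12 Al1 Al2; pose l s := if odd s then l2 else l1.
(* [e s <= l1] keeps all weights [w s] positive, as [l1 <= l s]. *)
pose e s : R := l1 * (s./2).+1%:R^-1.
have e0 s : 0 < e s by rewrite mulr_gt0// invr_gt0.
have lA s : ~ fredholm (scalar_minus (l s)%:C A) by rewrite /l; case: ifP.
have [g [g' [go g'o gg' Ag gl]]] := block_sequence ip_norm H_inf A_cont A_sa lA e0.
pose w s := rnorm (A (g s)).
have wl s : `|w s - l s| < e s.
  have g1 : rnorm (g s) = 1 by apply: (ip_self1 ip_norm); rewrite go eqxx.
  have lw : rnorm ((l s)%:C *: g s) = l s.
    by rewrite rnormZ rnorm_real g1 mulr1 ger0_norm// /l; case: ifP => _; lra.
  apply: le_lt_trans (gl s); rewrite ler_norml; apply/andP; split.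
    by rewrite lerNl opprB -{1}lw ler_rnormB.
  by rewrite rnormB -{1}lw ler_rnormB.
have el s : e s <= l1.
  by rewrite /e ler_piMr ?(ltW l1p)// invf_le1// ler1n.
have w0 s : 0 < w s.
  have := wl s; rewrite ltr_norml => /andP[h _]; have := el s.
  by move: h; rewrite /l; case: ifP => _; lra.
have wcvg (h : nat -> nat) l' : (forall n, (h n)./2 = n) -> (forall n, l (h n) = l') ->
    (fun n => w (h n)) @ \oo --> l'.
  move=> hn lh; apply/cvgrPdist_lt => d d0.
  have /cvgrPdist_lt/(_ (d / l1) (divr_gt0 d0 l1p)) := @cvg_harmonic R.
  apply: filterS => n; rewrite sub0r normrN gtr0_norm ?invr_gt0// ltr_pdivlMr// => nd.
  apply: lt_trans nd; have := wl (h n).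
  by rewrite lh distrC /e hn mulrC.
have wev : (fun n => w n.*2) @ \oo --> l1.
  by apply: wcvg => n; [exact: doubleK|rewrite /l odd_double].
have wod : (fun n => w n.*2.+1) @ \oo --> l2.
  by apply: wcvg => n; [rewrite /= uphalf_double|rewrite /l/= odd_double].
have [U Us UA] := block_shift ip_norm f_onb go g'o gg' Ag (fun=> erefl)
  (fun s => lt0r_neq0 (w0 s)).
exists U => // z; rewrite /open_annulus/= -rnormE !ltcR => /andP[zl1 zl2].
have z0 : 0 < rnorm z by lra.
apply: (chain_schauder_spectrum A_cont Us go UA _ z0); last by rewrite /= rnormE.
- by move=> n; exact: lt0r_neq0 (w0 _).
- apply: (@prod_ratio_cvgn (fun k => (w k.*2 / rnorm z) ^+ 2) ((l1 / rnorm z) ^+ 2)).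
  + by move=> k; exact: sqr_ge0.
  + have wz : (fun k => w k.*2 / rnorm z) @ \oo --> l1 / rnorm z by exact: cvgMl.
    exact: (cvgM wz wz).
  + by rewrite exprn_ilt1 ?divr_ge0 ?ltW// ltr_pdivrMr// mul1r.
- apply: (@prod_ratio_cvgn (fun k => (rnorm z / w k.*2.+1) ^+ 2) ((rnorm z / l2) ^+ 2)).
  + by move=> k; exact: sqr_ge0.
  + have wz : (fun k => rnorm z / w k.*2.+1) @ \oo --> rnorm z / l2.
      by apply: cvgMr; apply: cvgV => //; rewrite gt_eqF//; lra.
    exact: (cvgM wz wz).
  + by rewrite exprn_ilt1 ?divr_ge0 ?ltW// ?ltr_pdivrMr ?mul1r//; lra.
Qed.

(** All [t k] and [r k] are isolated eigenvalues, so there is an orthonormal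
    family of exact eigenvectors and [U] only has to shift it; the two
    summability hypotheses are those of the eigenvectors of the shift. *)
Lemma circle_schauder_spectrum (l1 : R) (t r : nat -> R) : 0 < l1 ->
  essential_spectrum A = [set l1%:C] ->
  (forall k, spectrum A (t k)%:C) -> (forall k, spectrum A (r k)%:C) ->
  (forall k, t k < t k.+1) -> (forall k, r k > r k.+1) ->
  t @ \oo --> l1 -> r @ \oo --> l1 ->
  cvgn (series (fun n => \prod_(k < n.+1) (t k / l1) ^+ 2)) ->
  cvgn (series (fun n => \prod_(k < n.+1) (l1 / r k) ^+ 2)) ->
  exists2 U : {linear H -> H}, unitary_spread ip U &
    [set z : R[i] | `|z| = l1%:C] `<=` schauder_spectrum ip (U \o A).
Proof.
move=> l1p Ae tA rA t_incr r_decr tl rl tcv rcv.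
have tl1 k : t k < l1.
  apply: lt_le_trans (t_incr k) _; rewrite -(cvg_lim (@Rhausdorff R) tl).
  apply: nondecreasing_cvgn_le; last by apply: cvgP tl.
  by apply/nondecreasing_seqP => n; exact: ltW.
have rl1 k : l1 < r k.
  apply: le_lt_trans _ (r_decr k); rewrite -(cvg_lim (@Rhausdorff R) rl).
  apply: nonincreasing_cvgn_ge; last by apply: cvgP rl.
  by apply/nonincreasing_seqP => n; exact: ltW.
have t_inj : injective t by apply: inc_inj; exact/increasing_seqP.
have r_inj : injective r.
  have Nr_inj : injective (fun k => - r k).
    by apply: inc_inj; apply/increasing_seqP => k; rewrite ltrN2.
  by move=> m n mn; apply: Nr_inj; rewrite mn.
have nAe (a : R) : a != l1 -> ~ essential_spectrum A a%:C.
  by move=> al; rewrite Ae/= => /complexI/eqP; rewrite (negPf al).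
have [x [xo Ax]] := eigenvector_sequence ip_norm A_cont A_sa t_inj tA
  (fun k => nAe _ (negbT (lt_eqF (tl1 k)))).
have [y [yo Ay]] := eigenvector_sequence ip_norm A_cont A_sa r_inj rA
  (fun k => nAe _ (negbT (gt_eqF (rl1 k)))).
have xy m n : ip (x m) (y n) = 0.
  apply: (eigenvectors_orthogonal A_sa (Ax m) (Ay n)).
  by rewrite lt_eqF// (lt_trans (tl1 m)).
have go := interleave_orthonormal xo yo xy.
have [U Us Ug] := orthonormal_permutation_spread ip_norm f_onb go next_siteK prev_siteK.
pose w s := if odd s then r s./2 else t s./2.
have wE n : w n.*2 = t n by rewrite /w odd_double doubleK.
have wO n : w n.*2.+1 = r n by rewrite /w/= odd_double/= uphalf_double.
exists U => //; apply: (@chain_schauder_spectrum A U _ w) go _ _ _ _ _ => //.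
- move=> s; rewrite -Ug -linearZ; congr (U _); rewrite /w /interleave.
  by case: (odd s); rewrite ?Ax ?Ay.
- by move=> n; rewrite wO gt_eqF// (lt_trans l1p).
- by under eq_fun do under eq_bigr do rewrite wE.
- by under eq_fun do under eq_bigr do rewrite wO.
Qed.

End Main.

Local Open Scope complex_scope.

Theorem theorem1p1 (R : realType) (H : completeNormedModType R[i])
    (ip : {dot H for Num.conj}) (ip_norm : norm_induced_by ip)
    (H_sep : separable H) (H_inf : infinite_dimensional H)
    (A : {linear H -> H}) (A_cont : continuous A)
    (A_sa : self_adjoint ip A) (A_schauder : schauder_operator ip A) :
  [/\ (forall l1 l2 : R, 0 < l1 -> l1 < l2 ->
        spectrum A `<=` (fun t : R => t%:C) @` `[l1, l2] ->
        essential_spectrum A l1%:C -> essential_spectrum A l2%:C ->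
        forall Q : set R[i], is_ring_in l1 l2 Q ->
        exists2 U : {linear H -> H}, unitary_spread ip U &
          Q `<=` schauder_spectrum ip (U \o A)),
      (forall l1 l2 : R, 0 < l1 -> l1 < l2 ->
        essential_spectrum A l1%:C -> essential_spectrum A l2%:C ->
        forall Q : set R[i], is_ring_in l1 l2 Q ->
        exists2 U : {linear H -> H}, unitary_spread ip U &
          Q `<=` schauder_spectrum ip (U \o A)) &
      (forall l1 : R, 0 < l1 ->
        essential_spectrum A = [set l1%:C] ->
        forall t r : nat -> R,
        (forall k, spectrum A (t k)%:C) -> (forall k, spectrum A (r k)%:C) ->
        (forall k, t k < t k.+1) -> (forall k, r k > r k.+1) ->
        t @ \oo --> l1 -> r @ \oo --> l1 ->
        cvgn (series (fun n => \prod_(k < n.+1) (t k / l1) ^+ 2)) ->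
        cvgn (series (fun n => \prod_(k < n.+1) (l1 / r k) ^+ 2)) ->
        exists2 U : {linear H -> H}, unitary_spread ip U &
          [set z : R[i] | `|z| = l1%:C] `<=` schauder_spectrum ip (U \o A))].
Proof.
have [f f_onb _] := A_schauder.
have rings (l1 l2 : R) : 0 < l1 -> l1 < l2 ->
    essential_spectrum A l1%:C -> essential_spectrum A l2%:C ->
    forall Q : set R[i], is_ring_in l1 l2 Q ->
    exists2 U : {linear H -> H}, unitary_spread ip U &
      Q `<=` schauder_spectrum ip (U \o A).
  move=> l1p l12 Al1 Al2 _ [a [b [l1a _ bl2 ->]]].
  have [U Us UQ] := annulus_schauder_spectrum ip_norm A_cont A_sa f_onb H_inf l1p l12 Al1 Al2.
  exists U => // z /andP[az zb]; apply: UQ; apply/andP; split.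
    by apply: le_lt_trans az; rewrite lecR.
  by apply: lt_le_trans zb _; rewrite lecR.
split=> // [l1 l2 l1p l12 _|l1 l1p Ae t r]; first exact: rings.
exact: (circle_schauder_spectrum ip_norm A_cont A_sa f_onb l1p Ae).
Qed.
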